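(* Let $\mathbb D$ be the projective Fraïssé limit of the family $\mathcal{T}_{\mathcal{M}3}$. Then $E(\mathbb D)$ is transitive, and the topological realization $|\mathbb D|$ is a dendrite whose set of ramification points is dense.
   Context: A graph is a pair $A=(V(A),E(A))$ with $E(A)\subseteq V(A)^2$ reflexive and symmetric. An epimorphism is a map on vertices sending edges to edges that is surjective on vertices and on edges. A topological graph is a graph whose vertex set is a compact, zero-dimensional, second-countable space and whose edge set is closed; epimorphisms between topological graphs are continuous. A subset $S\subseteq V(G)$ is disconnected if $S=P\cup Q$ with $P,Q$ nonempty disjoint closed and no edge between $P$ and $Q$; otherwise connected. An epimorphism is monotone if preimages of closed connected sets are connected. A tree is a finite graph in which any two distinct vertices are joined by a unique path of pairwise distinct vertices; the order of a vertex is the number of non-degenerate edges containing it. $\mathcal{T}_{\mathcal{M}3}$ is the class of trees with at least two vertices, all of order $\le 3$, with all monotone epimorphisms between them; it is a projective Fraïssé family, i.e. countably many isomorphism types, the epimorphisms are closed under composition and contain identities, and it has the joint projection and amalgamation properties. For such a family $\mathcal F$, $\mathcal F^\omega$ consists of inverse limits $\varprojlim\{F_n,\alpha_n\}$ with $F_n\in\mathcal F$ and bonding maps $\alpha_n$ in the family, with $\langle(a_n),(b_n)\rangle$ an edge iff $\langle a_n,b_n\rangle\in E(F_n)$ for all $n$; an epimorphism $h$ from such a limit to $A\in\mathcal F$ is in $\mathcal F^\omega$ iff $h=h'\circ\alpha^\infty_m$ for some $m$ and some $h'\colon F_m\to A$ in the family ($\alpha^\infty_m$ the projection). The projective Fraïssé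 limit is the unique $\mathbb F\in\mathcal F^\omega$ such that (i) for each $A\in\mathcal F$ there is an epimorphism $\mathbb F\to A$ in $\mathcal F^\omega$, and (ii) for $A,B\in\mathcal F$, $f\colon\mathbb F\to A$ in $\mathcal F^\omega$ and $g\colon B\to A$ in the family there is $h\colon \mathbb F\to B$ in $\mathcal F^\omega$ with $f=g\circ h$. When $E(\mathbb F)$ is transitive (hence an equivalence relation), the topological realization $|\mathbb F|$ is the quotient space $V(\mathbb F)/E(\mathbb F)$. A dendrite is a locally connected continuum that is hereditarily unicoherent and arcwise connected; a point $p$ of a continuum is a ramification point if it is the common endpoint of three arcs pairwise meeting only in $p$. *)

(* Defs.v *)
From HB Require Import structures.
From mathcomp Require Import all_boot all_order all_algebra.
From mathcomp Require Import all_classical all_reals all_analysis.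
From mathcomp Require Import Rstruct Rstruct_topology.
From mathcomp Require Import generic_quotient.



Unset Printing Implicit Defensive.
Import Order.TTheory GRing.Theory Num.Theory.

Record tgraph := FGraph { fV :> finType; fE : rel fV }.
Arguments fE : clear implicits.

Definition is_graph (G : tgraph) : Prop := reflexive (fE G) /\ symmetric (fE G).

Definition gpath (G : tgraph) (x y : G) (p : seq G) : bool :=
  [&& path (fE G) x p, uniq (x :: p) & last x p == y].

Definition is_tree (G : tgraph) : Prop :=
  is_graph G /\ forall x y : G, x != y -> exists! p : seq G, gpath G x y p.

Definition vorder (G : tgraph) (v : G) : nat :=
  #|[set w : G | (w != v) && fE G v w]|%N.

Definition inTM3 (G : tgraph) : Prop :=
  is_tree G /\ (1 < #|G|)%N /\ forall v : G, (vorder G v <= 3)%N.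

Definition is_epi (G H : tgraph) (f : G -> H) : Prop :=
  [/\ forall x y, fE G x y -> fE H (f x) (f y),
      forall b : H, exists a : G, f a = b &
      forall b1 b2 : H, fE H b1 b2 ->
        exists a1 a2 : G, [/\ fE G a1 a2, f a1 = b1 & f a2 = b2]].

Definition gconnected (G : tgraph) (S : {set G}) : Prop :=
  ~ exists P Q : {set G},
      [/\ P != finset.set0, Q != finset.set0, [disjoint P & Q], S = P :|: Q &
          forall p q, p \in P -> q \in Q -> ~~ fE G p q].

Definition is_monotone (G H : tgraph) (f : G -> H) : Prop :=
  forall S : {set H}, gconnected H S -> gconnected G (f @^-1: S).

Definition mono_epi (G H : tgraph) (f : G -> H) : Prop :=
  is_epi G H f /\ is_monotone G H f.

Local Open Scope classical_set_scope.
Local Open Scope ring_scope.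

Record invseq := InvSeq { sF : nat -> tgraph; sa : forall n, sF n.+1 -> sF n }.
Arguments sa : clear implicits.

Definition invseq_in_TM3 (S : invseq) : Prop :=
  (forall n, inTM3 (sF S n)) /\ forall n, mono_epi _ _ (sa S n).

Definition lprod (S : invseq) :=
  prod_topology (fun n => discrete_topology (sF S n)).

Definition limset (S : invseq) : set (lprod S) :=
  [set x | forall n, sa S n (x n.+1) = x n].

Definition limVert (S : invseq) := set_type (limset S).

(* sanity: the limit carries the subspace-of-product topology *)


Definition lproj (S : invseq) (m : nat) (x : limVert S) : sF S m := (set_val x) m.

Definition limE (S : invseq) (x y : limVert S) : Prop :=
  forall n, fE (sF S n) (lproj S n x) (lproj S n y).

Definition is_lepi (S : invseq) (A : tgraph) (h : limVert S -> A) : Prop :=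
  [/\ forall x y, limE S x y -> fE A (h x) (h y),
      forall b : A, exists a, h a = b &
      forall b1 b2 : A, fE A b1 b2 ->
        exists a1 a2, [/\ limE S a1 a2, h a1 = b1 & h a2 = b2]].

Definition in_Fomega (S : invseq) (A : tgraph) (h : limVert S -> A) : Prop :=
  exists (m : nat) (h' : sF S m -> A),
    mono_epi (sF S m) A h' /\ forall x, h x = h' (lproj S m x).

Definition is_Fomega_epi (S : invseq) (A : tgraph) (h : limVert S -> A) : Prop :=
  is_lepi S A h /\ in_Fomega S A h.

Definition is_TM3_Fraisse_limit (S : invseq) : Prop :=
  [/\ invseq_in_TM3 S,
      forall A : tgraph, inTM3 A -> exists h : limVert S -> A, is_Fomega_epi S A h &
      forall (A B : tgraph) (f : limVert S -> A) (g : B -> A),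
        inTM3 A -> inTM3 B -> is_Fomega_epi S A f -> mono_epi B A g ->
        exists h : limVert S -> B, is_Fomega_epi S B h /\ forall x, f x = g (h x)].

Section continua.
Variable X : topologicalType.
Local Notation R := Rdefinitions.R.

Definition metrizable : Prop :=
  exists d : X -> X -> R,
    [/\ forall x y, d x y = 0 <-> x = y,
        forall x y, d x y = d y x,
        forall x y z, d x z <= d x y + d y z &
        forall U : set X, open U <->
          forall x, U x -> exists2 e : R, 0 < e & [set y | d x y < e] `<=` U].

Definition continuum : Prop :=
  [/\ [set: X] !=set0, compact [set: X], connected [set: X],
      hausdorff_space X & metrizable].

Definition subcontinuum (K : set X) : Prop :=
  [/\ K !=set0, compact K & connected K].

Definition unicoherent_set (Y : set X) : Prop :=
  forall A B : set X, subcontinuum A -> subcontinuum B -> A `|` B = Y ->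
    connected (A `&` B).

Definition hereditarily_unicoherent : Prop :=
  forall Y : set X, subcontinuum Y -> unicoherent_set Y.

Definition locally_connected : Prop :=
  forall (x : X) (U : set X), nbhs x U ->
    exists V : set X, [/\ open V, V x, connected V & V `<=` U].

Definition I01 : set R := [set t | 0 <= t <= 1].

Definition is_arc (A : set X) (p q : X) : Prop :=
  exists f : R -> X,
    [/\ {within I01, continuous f},
        forall s t, I01 s -> I01 t -> f s = f t -> s = t,
        f @` I01 = A,
        (forall U : set R, open U ->
           exists2 V : set X, open V & f @` (U `&` I01) = V `&` A) &
        f 0 = p /\ f 1 = q].

Definition arcwise_connected : Prop :=
  forall p q : X, p <> q -> exists A : set X, is_arc A p q.

Definition dendrite : Prop :=
  [/\ continuum, locally_connected, hereditarily_unicoherent & arcwise_connected].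

Definition ramification_point (p : X) : Prop :=
  exists (A1 A2 A3 : set X) (q1 q2 q3 : X),
    [/\ is_arc A1 p q1, is_arc A2 p q2 & is_arc A3 p q3] /\
    [/\ A1 `&` A2 = [set p], A1 `&` A3 = [set p] & A2 `&` A3 = [set p]].

End continua.

(* Main.v *)
(* Every bonding map is a monotone epimorphism of trees, so it maps the interval (the vertex
   set of the path) between two vertices onto the interval between their images, and it
   preserves medians.  Hence intervals and medians survive in the limit.

   Subdividing an edge of a tree of the sequence is undone by a monotone epimorphism, so by
   the extension property the subdivision already occurs further down the sequence.  This
   forbids x E y E z with x, z not adjacent: after subdividing the edge from x to y, the
   point y has to lie over the new vertex, which is not adjacent to z.

   The quotient is treated through compactness: a closed set of the limit all of whose
   level images are connected has a connected image.  Two points c, d of the limit span the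
   set of threads lying between them at every level; its image lies in every subcontinuum
   through the images of c and d, which gives hereditary unicoherence, and it is an arc.  It
   is parametrised by x |-> sum_k 2^-(k+1) sup {u_k w | w between c and x}, where the u_k form
   a countable separating family of Urysohn functions, which also yields a metric.  Finally,
   splitting off a leaf produces a vertex of order 3 over any given vertex; the medians of
   three points over its neighbours form a ramification point. *)
Require Import Defs.
From HB Require Import structures.
From mathcomp Require Import all_boot all_order all_algebra.
From mathcomp Require Import all_classical all_reals all_analysis.
From mathcomp Require Import Rstruct Rstruct_topology.
From mathcomp Require Import generic_quotient.
From mathcomp Require Import lra.
Import Order.TTheory GRing.Theory Num.Theory numFieldNormedType.Exports.
Local Open Scope classical_set_scope.
Local Open Scope quotient_scope.
Set Implicit Arguments.
Unset Strict Implicit.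

(** * Connected sets and paths in finite graphs *)

Section GraphConnectivity.
Import boot.fintype boot.finset.
Context (G : tgraph) (gG : is_graph G).
Implicit Types (S P : {set G}).

(** Otherwise [S :&: P] and [S :\: P] would disconnect [S]. This turns the negative definition of
    connectedness into an induction principle along edges inside [S]. *)
Lemma gconnected_ind S P x : gconnected G S -> x \in S -> x \in P ->
  (forall a b, a \in S -> b \in S -> a \in P -> fE G a b -> b \in P) -> S \subset P.
Proof.
move=> cS xS xP step; apply: contrapT => /negP /subsetPn [y yS yP]; apply: cS.
exists (S :&: P), (S :\: P); split.
- by apply/set0Pn; exists x; rewrite inE xS.
- by apply/set0Pn; exists y; rewrite inE yS yP.
- by rewrite -setI_eq0; apply/eqP/setP => z; rewrite !inE; case: (z \in P); rewrite ?andbF.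
- by rewrite setID.
- move=> p q; rewrite !inE => /andP[pS pP] /andP[qP qS]; apply/negP => pq.
  by move: qP; rewrite (step p q).
Qed.

(** Converse of [gconnected_ind]: one half of a separation is closed under the edges inside [S],
    hence would be all of [S]. *)
Lemma gconnectedP S :
  (forall P x, x \in S -> x \in P ->
    (forall a b, a \in S -> b \in S -> a \in P -> fE G a b -> b \in P) -> S \subset P) ->
  gconnected G S.
Proof.
move=> H [P [Q [/set0Pn[p pP] /set0Pn[q qQ] dPQ SPQ nPQ]]].
have /subsetP/(_ q) : S \subset P.
  apply: (H P p) => //; first by rewrite SPQ inE pP.
  move=> a b _; rewrite SPQ inE => /orP[//|bQ] aP ab.
  by have := nPQ a b aP bQ; rewrite ab.
rewrite SPQ inE qQ orbT => /(_ isT) qP.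
by move: dPQ; rewrite -setI_eq0 => /eqP/setP/(_ q); rewrite !inE qP qQ.
Qed.

Lemma gconnected1 x : gconnected G [set x].
Proof. by apply: gconnectedP => P y; rewrite inE => /eqP-> xP _; rewrite sub1set. Qed.

Lemma gconnectedU S1 S2 x : gconnected G S1 -> gconnected G S2 ->
  x \in S1 -> x \in S2 -> gconnected G (S1 :|: S2).
Proof.
move=> c1 c2 x1 x2; apply: gconnectedP => P y yS yP st.
have st1 : x \in P -> S1 :|: S2 \subset P.
  move=> xP; rewrite subUset; apply/andP; split.
    by apply: (@gconnected_ind S1 P x) => // a b ? ?; apply: st; rewrite inE; apply/orP; left.
  by apply: (@gconnected_ind S2 P x) => // a b ? ?; apply: st; rewrite inE; apply/orP; right.
apply: st1; move: yS; rewrite inE => /orP[y1|y2].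
  have /subsetP : S1 \subset P; last exact.
  by apply: (@gconnected_ind S1 P y) => // a b ? ?; apply: st; rewrite inE; apply/orP; left.
have /subsetP : S2 \subset P; last exact.
by apply: (@gconnected_ind S2 P y) => // a b ? ?; apply: st; rewrite inE; apply/orP; right.
Qed.

Lemma gconnected2 x y : fE G x y -> gconnected G [set x; y].
Proof.
move=> xy; have yx : fE G y x by rewrite gG.2.
apply: gconnectedP => P z; rewrite !inE => /orP[]/eqP-> zP st.
- by rewrite subUset !sub1set zP /= (st x y) // !inE eqxx ?orbT.
- by rewrite subUset !sub1set zP andbT (st y x) // !inE eqxx ?orbT.
Qed.

(** The vertices reachable from [x] by steps ending in [S] are closed under edges inside [S];
    shortening such a walk removes its repetitions. *)
Lemma gconnected_path S x y : gconnected G S -> x \in S -> y \in S ->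
  exists2 p, gpath G x y p & {subset x :: p <= S}.
Proof.
move=> cS xS yS; pose e := [rel a b | [&& fE G a b & b \in S]].
have /subsetP/(_ y yS) : S \subset [set z | connect e x z].
  apply: (@gconnected_ind S _ x) => //; first by rewrite inE connect0.
  move=> a b aS bS; rewrite !inE => xa ab; apply: connect_trans xa _.
  by apply: connect1; rewrite /= ab.
rewrite inE => /connectP[p0 /shortenP[p ep up sub] ->].
have sp : {subset p <= S}.
  elim: p x ep {up xS sub p0} => //= b p IH x /andP[/andP[_ bS] ep] z; rewrite inE.
  by case/orP => [/eqP->//|]; apply: IH ep z.
exists p; last by move=> z; rewrite inE => /orP[/eqP->//|/sp].
apply/and3P; split => //; apply: sub_path ep => a b /= /andP[]//.
Qed.

Lemma path_in S x p : path (fE G) x p -> x \in S ->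
  (forall a b, a \in x :: p -> b \in x :: p -> a \in S -> fE G a b -> b \in S) ->
  {subset x :: p <= S}.
Proof.
elim: p x => [|b p IH] x /=; first by move=> _ xS _ z; rewrite inE => /eqP->.
move=> /andP[xb pb] xS st.
have bS : b \in S by apply: (st x b) => //; rewrite !inE eqxx ?orbT.
have := IH b pb bS.
move=> IH' z; rewrite inE => /orP[/eqP->//|]; apply: IH' => c d ci di; apply: st;
  by rewrite inE ?ci ?di orbT.
Qed.

Lemma path_gconnected x p : path (fE G) x p -> gconnected G [set z in x :: p].
Proof.
move=> pp; apply: gconnectedP => P y; rewrite inE => yp yP st.
have st' : forall q a, path (fE G) a q -> {subset a :: q <= x :: p} -> a \in P -> {subset q <= P}.
  elim=> [//|b q IH] a /= /andP[ab qb] sub aP.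
  have bP : b \in P by apply: (st a b) => //; rewrite inE sub // !inE eqxx ?orbT.
  have sb : {subset b :: q <= x :: p} by move=> w wq; apply: sub; rewrite inE wq orbT.
  by move=> z; rewrite inE => /orP[/eqP->//|]; apply: (IH b).
(* Membership in [P] first travels backwards from [y] to the start of the path, by symmetry of the
   edges; [st'] then carries it forward to every vertex. *)
have xP : x \in P.
  move: st' => _; elim: p x pp y yp yP st => [|b p IH] x /=.
    by move=> _ y; rewrite inE => /eqP->.
  move=> /andP[xb pb] y; rewrite inE => /orP[/eqP->//|yp] yP st.
  have bP : b \in P.
    apply: (IH b pb y yp yP) => c d; rewrite !in_set => ci di; apply: st;
    by rewrite in_set inE ?ci ?di orbT.
  by apply: (st b x) => //; rewrite ?inE ?eqxx ?orbT // gG.2.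
apply/subsetP => z; rewrite !inE => /orP[/eqP->//|zp]; exact: (st' p x).
Qed.

End GraphConnectivity.

(** * Trees characterised by edge cuts *)

Section Cuts.
Import boot.fintype boot.finset.
Context (G : tgraph) (gG : is_graph G).

(** The side of [a] once the edge from [a] to [b] is removed: that edge is the only one leaving
    [C]. *)
Definition is_cut (a b : G) (C : {set G}) :=
  [/\ a \in C, b \notin C & forall x y, x \in C -> y \notin C -> fE G x y -> x = a /\ y = b].

(** A path without repetitions crosses a cut edge at most once, so two paths with the same ends must
    start with the same edge; induction on the path gives uniqueness. *)
Lemma tree_of_cuts : gconnected G finset.setT ->
  (forall a b, a != b -> fE G a b -> exists C, is_cut a b C) -> is_tree G.
Proof.
move=> cG cut; split => // x y _.
have [p gp _] := gconnected_path cG (in_setT x) (in_setT y).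
exists p; split => // q; elim: p x q gp => [|b p IH] x q /and3P[pp up /eqP lp] /and3P[pq uq /eqP lq].
  case: q uq lq {pq} => // c q /=; rewrite -lp /= => /andP[xn _] lq.
  by move: xn; rewrite -lq mem_last.
move: pp up lp => /= /andP[xb pb] /andP[xnp unp] lp.
have xneb : x != b by apply: contraNneq xnp => ->; rewrite inE eqxx.
(* Cut along the first edge of [p]. The rest of [p] cannot re-enter [C] without revisiting [x], so
   [y] is outside [C]; a path [q] whose first step stays in [C] could leave it only through [x],
   which it does not revisit. *)
have [C [xC bC cr]] := cut _ _ xneb xb.
have yC : y \notin C.
  have sub : {subset b :: p <= ~: C}.
    apply: (@path_in G (~: C)) => //; first by rewrite inE.
    move=> s t si ti; rewrite !inE => sC st; apply/negP => tC.
    have [tx _] : t = x /\ s = b by apply: cr => //; rewrite gG.2.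
    by move: xnp; rewrite -tx ti.
  by rewrite -in_setC; apply: sub; rewrite -lp mem_last.
case: q pq uq lq => [|c q] /=; first by move=> _ _ xy; move: yC; rewrite -xy xC.
move=> /andP[xc qc] /andP[xnq unq] lq.
have [cC|cC] := boolP (c \in C); last first.
  have [_ cb] := cr x c xC cC xc; subst c; congr cons.
  by apply: (IH b) => //; rewrite /gpath /= ?pb ?unp ?lp ?qc ?unq ?lq eqxx.
have : {subset c :: q <= C}.
  apply: path_in => // s t si ti sC st; apply: contraT => tC.
  by have [sx _] := cr s t sC tC st; move: xnq; rewrite -sx si.
by move=> /(_ y); rewrite -lq mem_last lq (negbTE yC) => /(_ isT).
Qed.

Hypothesis tG : is_tree G.

Lemma tree_gpath x y : exists p, gpath G x y p.
Proof.
have [<-|xy] := eqVneq x y; first by exists [::]; rewrite /gpath /= eqxx.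
by have [p [gp _]] := tG.2 _ _ xy; exists p.
Qed.

Lemma tree_gpath_uniq x y p q : gpath G x y p -> gpath G x y q -> p = q.
Proof.
have [<-|xy] := eqVneq x y; last first.
  by have [r [_ ur]] := tG.2 _ _ xy => /ur <- /ur <-.
have nil r : gpath G x x r -> r = [::].
  case: r => // a r /and3P[_ /= /andP[+ _] /eqP lr].
  by rewrite -[X in X \notin _]lr mem_last.
by move=> /nil-> /nil->.
Qed.

Lemma tree_gconnected : gconnected G finset.setT.
Proof.
apply: gconnectedP => P x _ xP st; apply/subsetP => y _.
have [p /and3P[pp _ /eqP <-]] := tree_gpath x y.
have sub := path_in pp xP (fun a b _ _ => st a b (in_setT _) (in_setT _)).
by apply: sub; rewrite mem_last.
Qed.

(** The component of [a] after deletion of the edge works: if it contained [b], a second path from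
    [a] to [b] would avoid that edge. *)
Lemma tree_cut a b : a != b -> fE G a b -> exists C, is_cut a b C.
Proof.
move=> ab eab.
pose e := [rel x y | [&& fE G x y, ~~ ((x == a) && (y == b)) & ~~ ((x == b) && (y == a))]].
have bC : ~~ connect e a b.
  apply/negP => /connectP[p0 /shortenP[p ep up _] lp].
  have /tree_gpath_uniq/(_ (_ : gpath G a b [:: b])) : gpath G a b p.
    apply/and3P; split => //; last by rewrite -lp.
    by apply: sub_path ep => x y /= /andP[].
  rewrite /gpath /= eab eqxx !andbT inE => /(_ ab) pE.
  by move: ep; rewrite pE /= !eqxx andbF.
exists [set z | connect e a z]; split; rewrite ?inE ?connect0 // => x y; rewrite !inE => ax ay xy.
have : ~~ e x y by apply: contra ay => exy; apply: (connect_trans ax); apply: connect1.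
rewrite /= xy /= negb_and !negbK => /orP[/andP[/eqP-> /eqP->]//|/andP[/eqP xb _]].
by move: ax; rewrite xb (negbTE bC).
Qed.

End Cuts.

(** * Intervals and medians in trees *)

Section Intervals.
Import boot.fintype boot.finset.
Context (G : tgraph) (tG : is_tree G).
Implicit Types (a b c d u v w x y z : G).
Let gG : is_graph G := tG.1.

Definition seg x y : {set G} :=
  locked [set z | `[< exists2 p, gpath G x y p & z \in x :: p >]].

Lemma segP x y z : reflect (exists2 p, gpath G x y p & z \in x :: p) (z \in seg x y).
Proof. by rewrite /seg -lock inE; apply: asboolP. Qed.

Lemma gpath_split x y z p : gpath G x y p -> z \in x :: p ->
  exists p1 p2, [/\ p = p1 ++ p2, gpath G x z p1 & gpath G z y p2].
Proof.
move=> /and3P[pp up /eqP lp] zp; case/splitPl: zp pp up lp => p1 p2 lz.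
rewrite cat_path -cat_cons cat_uniq last_cat lz => /andP[pp1 pp2] /and3P[u1 hd u2] lp.
exists p1, p2; split => //; first by rewrite /gpath pp1 u1 lz eqxx.
rewrite /gpath pp2 lp eqxx andbT /= u2 andbT.
by apply: contra hd => zp2; apply/hasP; exists z; rewrite // -lz mem_last.
Qed.

Lemma gpath_cat x y z p1 p2 : gpath G x z p1 -> gpath G z y p2 ->
  (forall w, w \in x :: p1 -> w \notin p2) -> gpath G x y (p1 ++ p2).
Proof.
move=> /and3P[pp1 u1 /eqP l1] /and3P[pp2 /= /andP[_ u2] /eqP l2] dis.
rewrite /gpath cat_path last_cat l1 pp1 pp2 l2 eqxx andbT /= mem_cat negb_or.
move: u1 => /= /andP[xp1 u1]; rewrite cat_uniq xp1 u1 u2 (dis x (mem_head _ _)) /= andbT.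
by rewrite andbT; apply/hasPn => w wp2; apply: contraL wp2 => wp1; apply: dis; rewrite inE wp1 orbT.
Qed.

(** Intervals are the smallest connected sets containing both ends. Together with [seg_gconnected]
    this lets most later arguments avoid explicit paths. *)
Lemma seg_sub_gconnected (C : {set G}) x y : gconnected G C -> x \in C -> y \in C ->
  seg x y \subset C.
Proof.
move=> cC xC yC; apply/subsetP => z /segP[p gp zp].
have [q gq sub] := gconnected_path cC xC yC.
by apply: sub; rewrite (tree_gpath_uniq tG gq gp).
Qed.

Lemma seg_gconnected x y : gconnected G (seg x y).
Proof.
have [p gp] := tree_gpath tG x y.
suff -> : seg x y = [set z in x :: p] by apply: path_gconnected => //; case/and3P: gp.
apply/setP => z; apply/segP/idP; rewrite [z \in [set _ in _]]inE.
  by move=> [q gq]; rewrite (tree_gpath_uniq tG gq gp).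
by exists p.
Qed.

Lemma seg_left x y : x \in seg x y.
Proof. by have [p gp] := tree_gpath tG x y; apply/segP; exists p; rewrite ?mem_head. Qed.

Lemma seg_right x y : y \in seg x y.
Proof.
have [p gp] := tree_gpath tG x y; apply/segP; exists p => //.
by case/and3P: gp => _ _ /eqP <-; rewrite mem_last.
Qed.

Lemma segC x y : seg x y = seg y x.
Proof.
by apply/eqP; rewrite eqEsubset !seg_sub_gconnected ?seg_left ?seg_right //;
  apply: seg_gconnected.
Qed.

Lemma segxx x : seg x x = [set x].
Proof.
apply/eqP; rewrite eqEsubset sub1set seg_left andbT.
by apply: seg_sub_gconnected; rewrite ?inE //; apply: gconnected1.
Qed.

Lemma seg_adj x y : fE G x y -> seg x y = [set x; y].
Proof.
move=> xy; apply/eqP; rewrite eqEsubset subUset !sub1set seg_left seg_right !andbT.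
by apply: seg_sub_gconnected; rewrite ?inE ?eqxx ?orbT //; apply: gconnected2.
Qed.

Lemma seg_subl x y z : z \in seg x y -> seg x z \subset seg x y.
Proof.
by move=> zxy; apply: seg_sub_gconnected; rewrite ?seg_left //; apply: seg_gconnected.
Qed.

Lemma seg_subr x y z : z \in seg x y -> seg z y \subset seg x y.
Proof.
by move=> zxy; apply: seg_sub_gconnected; rewrite ?seg_right //; apply: seg_gconnected.
Qed.

Lemma seg_subU x y z : seg x y \subset seg x z :|: seg z y.
Proof.
apply: seg_sub_gconnected; rewrite ?inE ?seg_left ?seg_right ?orbT //.
apply: (@gconnectedU _ _ _ z); rewrite ?seg_left ?seg_right //; exact: seg_gconnected.
Qed.

(** The vertices [x], [w], [z], [y] occur in this order on one path, and its tail from [w] still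
    passes through [z]. *)
Lemma seg_shift x y z w : w \in seg x z -> z \in seg x y -> z \in seg w y.
Proof.
move=> /segP[q gq wq] /segP[p gp zp].
have [p1 [p2 [_ g1 g2]]] := gpath_split gp zp.
move: wq; rewrite (tree_gpath_uniq tG gq g1) => wp1.
have [q1 [q2 [p1E h1 h2]]] := gpath_split g1 wp1.
have g : gpath G w y (q2 ++ p2).
  apply: (gpath_cat h2 g2) => t tq2; apply/negP => tp2.
  have [r1 [r2 [pE g1' g2']]] := gpath_split gp zp.
  have := gp; rewrite pE (tree_gpath_uniq tG g1' g1) (tree_gpath_uniq tG g2' g2).
    move=> /and3P[_ + _]; rewrite -cat_cons cat_uniq => /and3P[_ /hasPn/(_ t tp2) /negP[]].
    move: tq2; rewrite p1E !inE mem_cat => /orP[/eqP->|->]; last by rewrite !orbT.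
    by case/and3P: h1 => _ _ /eqP <-; have := mem_last x q1; rewrite inE => /orP[/eqP->|->];
      rewrite ?eqxx ?orbT.
apply/segP; exists (q2 ++ p2) => //.
by case/and3P: h2 => _ _ /eqP <-; rewrite -cat_cons mem_cat mem_last.
Qed.

Lemma seg_anti c u v : u \in seg c v -> v \in seg c u -> u = v.
Proof. by move=> uv vu; have := seg_shift uv vu; rewrite segxx inE => /eqP. Qed.

(** With [seg_anti], this makes membership in [seg c _] a linear order on [seg c d], oriented away
    from [c]. *)
Lemma seg_total c d u v : u \in seg c d -> v \in seg c d -> u \in seg c v \/ v \in seg c u.
Proof.
move=> ud vd; have := subsetP (seg_subU c d v) _ ud; rewrite inE => /orP[|uvd]; first by left.
by right; rewrite segC; rewrite segC in uvd; apply: seg_shift uvd _; rewrite segC.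
Qed.

Lemma seg_mid a b v : fE G a v -> fE G v b -> a != v -> v != b -> a != b -> v \in seg a b.
Proof.
move=> av vb nav nvb nab; apply/segP; exists [:: v; b]; last by rewrite !inE eqxx orbT.
by rewrite /gpath /= av vb !inE negb_or nav nab nvb eqxx.
Qed.

Lemma seg_join c b z : (forall w, w \in seg c z -> w \in seg z b -> w = z) -> z \in seg c b.
Proof.
move=> H; have [p1 g1] := tree_gpath tG c z; have [p2 g2] := tree_gpath tG z b.
have g : gpath G c b (p1 ++ p2).
  apply: (gpath_cat g1 g2) => w w1; apply/negP => w2.
  have wz : w = z by apply: H; apply/segP; [exists p1|exists p2] => //; rewrite inE w2 orbT.
  by case/and3P: g2 => _ /= /andP[]; rewrite -wz w2.
by apply/segP; exists (p1 ++ p2) => //; case/and3P: g1 => _ _ /eqP<-;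
  rewrite -cat_cons mem_cat mem_last.
Qed.

Definition is_median a b c z := [/\ z \in seg a b, z \in seg b c & z \in seg a c].

(** Among the common vertices of [seg c a] and [seg a b], take one closest to [c], measured by the
    size of [seg c z]. By minimality [seg c z] and [seg z b] meet only in [z], so they concatenate
    to a path from [c] to [b]. *)
Lemma median_exists a b c : exists z, is_median a b c z.
Proof.
have aP : (a \in seg c a) && (a \in seg a b) by rewrite seg_left seg_right.
case: (@arg_minnP _ a (fun z => (z \in seg c a) && (z \in seg a b))
  (fun z => #|seg c z|) aP) => z /andP[zca zab] zmin.
exists z; split => //; last by rewrite segC.
rewrite segC; apply: seg_join => w wcz wzb.
have sub := seg_subl wcz.
have : #|seg c z| <= #|seg c w|.
  apply: zmin; rewrite (subsetP (seg_subl zca)) //=.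
  exact: (subsetP (seg_subr zab)).
move=> le; have /eqP E : seg c w == seg c z by rewrite eqEcard sub.
by apply: (@seg_anti c) => //; rewrite E seg_right.
Qed.

Lemma median_uniq a b c z w : is_median a b c z -> is_median a b c w -> z = w.
Proof.
wlog : z w / w \in seg a z => [H mz mw|waz [zab zbc zac] [wab wbc wac]].
  have [zab _ _] := mz; have [wab _ _] := mw.
  have [zw|wz] := seg_total zab wab; last exact: (H z w).
  by symmetry; apply: (H w z).
have zwc := seg_shift waz zac.
have zbw : z \in seg b w by rewrite segC; apply: seg_shift waz zab.
have wzc := seg_shift zbw wbc.
by apply: (@seg_anti c); rewrite segC.
Qed.

End Intervals.

(** * Monotone epimorphisms, intervals and medians *)

Section MonotoneMaps.
Import boot.fintype boot.finset.
Context (G H : tgraph) (tG : is_tree G) (tH : is_tree H).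

Lemma gconnected_imset (f : G -> H) (C : {set G}) :
  (forall x y, fE G x y -> fE H (f x) (f y)) -> gconnected G C -> gconnected H (f @: C).
Proof.
move=> fe cC; apply: gconnectedP => P _ /imsetP[x xC ->] fxP st.
have /subsetP sub : C \subset f @^-1: P.
  apply: (@gconnected_ind _ _ _ x cC xC); rewrite ?inE // => a b aC bC; rewrite !inE => aP ab.
  by apply: (st (f a)); rewrite ?imset_f ?fe.
by apply/subsetP => _ /imsetP[y yC ->]; have := sub y yC; rewrite inE.
Qed.

Context (f : G -> H) (mf : mono_epi G H f).

(** Monotonicity makes the preimage of the target interval connected, so it contains the interval
    upstairs. *)
Lemma mono_seg x y z : z \in seg x y -> f z \in seg (f x) (f y).
Proof.
move=> zi; have cI := mf.2 _ (@seg_gconnected _ tH (f x) (f y)).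
have /subsetP/(_ z zi) : seg x y \subset f @^-1: seg (f x) (f y).
  by apply: seg_sub_gconnected => //; rewrite inE ?seg_left ?seg_right.
by rewrite inE.
Qed.

(** The image of an interval is connected and contains both end images, hence the whole interval
    between them. *)
Lemma mono_seg_lift x y v : v \in seg (f x) (f y) -> exists2 u, u \in seg x y & f u = v.
Proof.
have [[fe _ _] _] := mf.
have cI := gconnected_imset fe (@seg_gconnected _ tG x y).
have /subsetP sub := seg_sub_gconnected tH cI (imset_f f (seg_left tG x y)) (imset_f f (seg_right tG x y)).
by move=> /sub /imsetP[u ui ->]; exists u.
Qed.

Lemma mono_median x y z m : is_median x y z m -> is_median (f x) (f y) (f z) (f m).
Proof. by case=> *; split; apply: mono_seg. Qed.

End MonotoneMaps.

Lemma mono_epi_comp (G H K : tgraph) (f : G -> H) (g : H -> K) :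
  mono_epi G H f -> mono_epi H K g -> mono_epi G K (g \o f).
Proof.
move=> [[fe fs fse] fm] [[ge gs gse] gm]; split.
  split=> [x y /fe/ge//|c|c1 c2 /gse[b1 [b2 [/fse[a1 [a2 [a12 <- <-]]] <- <-]]]].
    by have [b <-] := gs c; have [a <-] := fs b; exists a.
  by exists a1, a2.
move=> C /gm/fm; congr gconnected; apply/boot.finset.setP => x; by rewrite !boot.finset.inE.
Qed.

Lemma mono_epi_id (G : tgraph) : mono_epi G G id.
Proof.
split; first by split=> // [b|b1 b2 b12]; [exists b|exists b1, b2].
by move=> C; congr gconnected; apply/boot.finset.setP => x; rewrite boot.finset.inE.
Qed.

(** * Splitting a vertex *)

Lemma is_cutC (G : tgraph) (a b : G) C : is_graph G -> is_cut a b C ->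
  is_cut b a (finset.setC C).
Proof.
move=> gG [aC bC cr]; split; rewrite ?boot.finset.inE ?negbK // => x y.
rewrite !boot.finset.inE negbK => xC yC xy.
by have [] := cr y x yC xC; rewrite // gG.2.
Qed.

Section VertexSplitting.
Import boot.fintype boot.finset.
Context (T : tgraph) (v : T) (Q : {set T}).

Definition nbrs (u : T) : {set T} := [set w : T | (w != u) && fE T u w].

Definition split_rel (x y : option T) : bool :=
  match x, y with
  | None, None => true
  | None, Some u | Some u, None => (u == v) || (u \in Q)
  | Some u, Some w => [&& fE T u w, ~~ ((u == v) && (w \in Q)) & ~~ ((w == v) && (u \in Q))]
  end.

(* The vertex [v] is replaced by the edge [Some v -- None]; the neighbours of [v] lying in
   [Q] are reattached to [None].  For [#|Q| = 1] this subdivides an edge, for [Q] empty it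
   attaches a leaf. *)
Definition split_graph := @FGraph (option T) split_rel.

Definition collapse (x : split_graph) : T := odflt v x.

Hypotheses (TM : inTM3 T) (Qn : Q \subset nbrs v).
Let gT : is_graph T := TM.1.1.

Let vQ : v \notin Q.
Proof. by apply/negP => /(subsetP Qn); rewrite inE eqxx. Qed.

Let Qe u : u \in Q -> fE T v u.
Proof. by move=> /(subsetP Qn); rewrite inE => /andP[]. Qed.

Let Qe' u : u \in Q -> fE T u v.
Proof. by move=> uQ; rewrite gT.2 Qe. Qed.

Lemma split_is_graph : is_graph split_graph.
Proof.
split=> [[x|]|[x|] [y|]] //=; last first.
  by rewrite gT.2; case: (fE T y x) => //=; rewrite andbC.
rewrite gT.1 /= andbb; apply/negP => /andP[/eqP-> ]; exact/negP.
Qed.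

Lemma collapse_edge x y : fE split_graph x y -> fE T (collapse x) (collapse y).
Proof.
case: x y => [x|] [y|] //=; rewrite /collapse /=.
- by case/and3P.
- by case/orP => [/eqP->|/Qe'//]; rewrite gT.1.
- by case/orP => [/eqP->|/Qe//]; rewrite gT.1.
- by rewrite gT.1.
Qed.

(** The two vertices over [v] are adjacent, so an edge-closed set contains both or neither; every
    other edge of [T] lifts, with [v] lifted to [None] exactly when the other end lies in [Q]. *)
Lemma collapse_monotone : is_monotone split_graph T collapse.
Proof.
move=> C cC; apply: gconnectedP => P x xC xP st.
have vN : v \in C -> (Some v \in P) = (None \in P).
  move=> vC; apply/idP/idP => [sP|nP].
    by apply: (st (Some v) None) => //; rewrite ?inE //= eqxx.
  by apply: (st None (Some v)) => //; rewrite ?inE //= eqxx.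
have CP : C \subset [set t | Some t \in P].
  apply: (@gconnected_ind _ _ _ (collapse x)) => //; first by rewrite inE in xC.
    rewrite inE; case: x xC xP => [x|] //=; rewrite inE /collapse /= => vC.
    by rewrite vN.
  move=> a b aC bC; rewrite !inE => aP ab.
  have [/andP[/eqP av bQ]|n1] := boolP ((a == v) && (b \in Q)).
    subst a; apply: (st None (Some b)); rewrite ?inE //= ?bQ ?orbT //.
    by rewrite -vN.
  have [/andP[/eqP bv aQ]|n2] := boolP ((b == v) && (a \in Q)).
    subst b; rewrite vN //; apply: (st (Some a) None); rewrite ?inE //= ?aQ ?orbT //.
  by apply: (st (Some a) (Some b)); rewrite ?inE //= ab n1 n2.
apply/subsetP => -[t|]; rewrite inE /collapse /= => tC.
  by have := subsetP CP _ tC; rewrite inE.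
by rewrite -vN //; have := subsetP CP _ tC; rewrite inE.
Qed.

Lemma collapse_mono_epi : mono_epi split_graph T collapse.
Proof.
split; last exact: collapse_monotone.
split; first exact: collapse_edge.
  by move=> b; exists (Some b).
move=> a b ab.
have [/andP[/eqP av bQ]|n1] := boolP ((a == v) && (b \in Q)).
  by exists None, (Some b); split; rewrite //= ?bQ ?orbT.
have [/andP[/eqP bv aQ]|n2] := boolP ((b == v) && (a \in Q)).
  by exists (Some a), None; split; rewrite //= ?aQ ?orbT.
by exists (Some a), (Some b); split; rewrite //= ab n1 n2.
Qed.

(** Cuts are supplied for every edge. Edges between old vertices and edges from [None] to [Q] pull
    back a cut of [T] along [collapse]; only the new edge from [None] to [Some v] needs a cut of its
    own. *)
Lemma split_is_tree : is_tree split_graph.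
Proof.
apply: tree_of_cuts; first exact: split_is_graph.
  have := collapse_monotone (tree_gconnected TM.1); congr gconnected.
  by apply/setP => x; rewrite !inE.
have cutSS a b : a != b -> fE split_graph (Some a) (Some b) ->
    exists C, @is_cut split_graph (Some a) (Some b) C.
  move=> nab /= /and3P[ab n1 n2]; have [C [aC bC cr]] := tree_cut TM.1 nab ab.
  exists (collapse @^-1: C); split; rewrite ?inE //= => x y; rewrite !inE => xC yC xy.
  have [xa yb] := cr _ _ xC yC (collapse_edge xy).
  case: x y xa yb xC yC xy => [x|] [y|]; rewrite /collapse /=.
  - by move=> -> ->.
  - move=> -> vb _ _; rewrite vb eqxx in n2; rewrite vb (negbTE nab) /= => aQ.
    by rewrite aQ in n2.
  - move=> va -> _ _; rewrite va eqxx in n1; rewrite va eq_sym (negbTE nab) /= => bQ.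
    by rewrite bQ in n1.
  - by move=> va vb; move: nab; rewrite -va -vb eqxx.
have cutNQ b : b \in Q -> exists C, @is_cut split_graph None (Some b) C.
  move=> bQ; have nvb : v != b by apply: contraNneq vQ => ->.
  have [C [vC bC cr]] := tree_cut TM.1 nvb (Qe bQ).
  exists (collapse @^-1: C); split; rewrite ?inE //= => x y; rewrite !inE => xC yC xy.
  have [xa yb] := cr _ _ xC yC (collapse_edge xy).
  case: y yb yC xy => [y|]; rewrite /collapse /=; last by move=> vb; rewrite vb eqxx in nvb.
  move=> ->.
  case: x xa xC => [x|] //=; rewrite /collapse /= => -> _ _.
  by rewrite eqxx bQ /= andbF.
have cutNv : exists C, @is_cut split_graph None (Some v) C.
  (* The side of [None] consists of [None] and the branches of [T] at [v] that start in [Q]. *)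
  pose D := [set x : split_graph | if x is Some u
    then `[< exists q C, [/\ q \in Q, is_cut q v C & u \in C] >] else true].
  exists D; split; first by rewrite inE.
    by rewrite inE; apply/negP => /asboolP[q [C [_ [_ vC _] vC']]]; rewrite vC' in vC.
  move=> [u|] [w|]; rewrite !inE //.
    move=> /asboolP[q [C [qQ cC uC]]] wD /= /and3P[uw n1 n2].
    have wC : w \notin C by apply: contra wD => wC; apply/asboolP; exists q, C.
    have [_ _ cr] := cC; have [uq wv] := cr _ _ uC wC uw.
    by move: n2; rewrite wv uq eqxx qQ.
  move=> _ wD /= /orP[/eqP->//|wQ]; exfalso; move/negP: wD; apply; apply/asboolP.
  have nwv : w != v by apply: contraNneq vQ => <-.
  have [C cC] := tree_cut TM.1 nwv (Qe' wQ).
  by exists w, C; split => //; case: cC.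
have cutN b : fE split_graph None (Some b) -> exists C, @is_cut split_graph None (Some b) C.
  by move=> /= /orP[/eqP->//|]; apply: cutNQ.
move=> [a|] [b|] // nab ab; [exact: cutSS| |exact: cutN].
have [C cC] := cutN a ab; exists (~: C).
exact: is_cutC split_is_graph cC.
Qed.

Hypotheses (Q2 : #|Q| <= 2) (NQ2 : #|nbrs v :\: Q| <= 2).

(** [None] sees [Some v] and [Q], while [Some v] sees [None] and the neighbours outside [Q]: at most
    1 + 2 each. Any other vertex is adjacent to at most one of these two, so [collapse] is injective
    on its neighbours and its order does not grow. *)
Lemma split_inTM3 : inTM3 split_graph.
Proof.
split; first exact: split_is_tree.
split; first by rewrite card_option ltnS ltnW // TM.2.1.
move=> [u|]; last first.
  apply: leq_trans (_ : #|Some v |: [set Some q | q in Q]| <= 3).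
    apply: subset_leq_card; apply/subsetP => -[w|]; rewrite !inE //= => /orP[/eqP->|wQ].
      by rewrite eqxx.
    by apply/orP; right; apply: imset_f.
  by rewrite cardsU1 (leq_add (leq_b1 _)) // (leq_trans (leq_imset_card _ _)).
have [->|uv] := eqVneq u v.
  apply: leq_trans (_ : #|None |: [set Some w | w in nbrs v :\: Q]| <= 3).
    apply: subset_leq_card; apply/subsetP => -[w|]; rewrite !inE //= => /andP[wv].
    move=> /and3P[vw + _]; rewrite eqxx /= => wQ.
    by apply/imsetP; exists w; rewrite // !inE wQ vw andbT; apply: contra wv => /eqP->.
  by rewrite cardsU1 (leq_add (leq_b1 _)) // (leq_trans (leq_imset_card _ _)).
apply: leq_trans (TM.2.2 u); rewrite /vorder.
rewrite -(@card_in_imset _ _ collapse).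
  apply: subset_leq_card; apply/subsetP => _ /imsetP[x xN ->].
  move: xN; rewrite !inE => /andP[xu ux].
  have /= -> := collapse_edge ux; rewrite andbT.
  by case: x xu ux => [x|] /=; rewrite /collapse /= ?[v == u]eq_sym.
have H x : fE split_graph (Some u) x -> collapse x = v -> x = (if u \in Q then None else Some v).
  case: x => [x|] /=; rewrite /collapse /= => + xv; last by rewrite (negbTE uv) /= => ->.
  by rewrite xv eqxx /= => /and3P[_ _ /negbTE->].
move=> x y; rewrite !inE => /andP[_ ux] /andP[_ uy] xy.
have [xv|xv] := eqVneq (collapse x) v; first by rewrite (H x) // (H y) // -xy.
by case: x y xy xv {ux uy} => [x|] [y|]; rewrite /collapse /= ?eqxx // => ->; rewrite ?eqxx.
Qed.

End VertexSplitting.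

(** * Inverse limits of trees *)

(** Cantor intersection: a cluster point of the filter generated by the [C n] lies in all of
    them. *)
Lemma compact_nested (T : topologicalType) (C : nat -> set T) :
  compact [set: T] -> (forall n, closed (C n)) -> (forall n, C n.+1 `<=` C n) ->
  (forall n, C n !=set0) -> exists x, forall n, C n x.
Proof.
move=> cT cC dC nC.
have dec n k : (n <= k)%N -> C k `<=` C n.
  elim: k => [|k IH]; first by rewrite leqn0 => /eqP->.
  rewrite leq_eqVlt => /orP[/eqP->//|/IH]; exact: subset_trans.
pose F : set_system T := [set A | exists n, C n `<=` A].
have FF : ProperFilter F.
  split; first by move=> [n]; have [x xC] := nC n => /(_ x xC).
  split; first by exists 0%N.
    move=> A B [n nA] [m mB]; exists (maxn n m) => x xC.
    by split; [apply/nA/dec/xC/leq_maxl|apply/mB/dec/xC/leq_maxr].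
  by move=> A B AB [n nA]; exists n; apply: subset_trans AB.
have [|x [_ xF]] := cT F FF; first by exists 0%N.
by exists x => n; apply: cC => B Bx; apply: xF => //; exists n.
Qed.

(** Above level [n] the thread is built by choosing lifts, below by applying [f]. The induction on
    [n] shifts the whole system by one level, which is why [U], [f] and [P] are generalised. *)
Lemma thread_lift (U : nat -> Type) (f : forall n, U n.+1 -> U n) (P : forall n, U n -> Prop) :
  (forall n u, P n.+1 u -> P n (f n u)) ->
  (forall n v, P n v -> exists2 u, P n.+1 u & f n u = v) ->
  forall n v, P n v -> exists x : forall k, U k,
    [/\ forall k, f k (x k.+1) = x k, forall k, P k (x k) & x n = v].
Proof.
move=> fP lP n; elim: n U f P fP lP => [|n IH] U f P fP lP v vP; last first.
  have [x [xf xP xn]] := IH (fun k => U k.+1) (fun k => f k.+1) (fun k => @P k.+1)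
    (fun k => @fP k.+1) (fun k => @lP k.+1) v vP.
  exists (fun k => if k is j.+1 then x j else f 0%N (x 0%N)); split => //; first by case.
  by case=> [|k]; [apply: fP; apply: xP|apply: xP].
have lift k (w : {u | P k u}) : {w' : {u | P k.+1 u} | f k (projT1 w') = projT1 w}.
  have [u] := cid2 (lP k _ (projT2 w)); move=> uP uw.
  by exists (exist _ u uP).
pose y := nat_rect (fun k => {u | P k u}) (exist _ v vP) (fun k w => projT1 (lift k w)).
exists (fun k => projT1 (y k)); split => // k; last exact: (projT2 (y k)).
exact: (projT2 (lift k (y k))).
Qed.

Section Limit.
Context (S : invseq) (SM : invseq_in_TM3 S).
Local Notation X := (limVert S).
Local Notation "x @_ n" := (lproj S n x) (at level 5).

Let gS n : is_graph (sF S n) := (SM.1 n).1.1.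
Let tS n : is_tree (sF S n) := (SM.1 n).1.

Lemma lproj_succ n (x : X) : sa S n (x @_ n.+1) = x @_ n.
Proof. by have := set_valP x; apply. Qed.

Lemma limVert_ext (x y : X) : (forall n, x @_ n = y @_ n) -> x = y.
Proof. by move=> H; apply: val_inj; apply: functional_extensionality_dep. Qed.

Lemma limVert_thread (x : forall n, sF S n) : (forall n, sa S n (x n.+1) = x n) ->
  exists y : X, forall n, y @_ n = x n.
Proof.
move=> xT; pose x' : lprod S := x.
have xl : x' \in limset S by rewrite inE.
by exists (exist _ x' xl).
Qed.

(** The composite of the bonding maps from level [k] to level [n], stated existentially to avoid
    dependent casts along [n <= k]. *)
Lemma level_map n k : (n <= k)%N ->
  exists f : sF S k -> sF S n, mono_epi _ _ f /\ forall x : X, f (x @_ k) = x @_ n.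
Proof.
elim: k => [|k IH]; first by rewrite leqn0 => /eqP->; exists id; split=> //; apply: mono_epi_id.
rewrite leq_eqVlt => /orP[/eqP->|/IH[f [mf fx]]].
  by exists id; split=> //; apply: mono_epi_id.
exists (f \o sa S k); split; first by apply: mono_epi_comp mf; apply: SM.2.
by move=> x /=; rewrite lproj_succ.
Qed.

Lemma lproj_eq_le n k (x y : X) : (n <= k)%N -> x @_ k = y @_ k -> x @_ n = y @_ n.
Proof. by move=> /level_map[f [_ fx]] xy; rewrite -!fx xy. Qed.

Lemma lproj_adj_le n k (x y : X) : (n <= k)%N ->
  fE _ (x @_ k) (y @_ k) -> fE _ (x @_ n) (y @_ n).
Proof. by move=> /level_map[f [[[fe _ _] _] fx]] xy; rewrite -!fx; apply: fe. Qed.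

Lemma limE_refl (x : X) : limE S x x.
Proof. by move=> n; apply: (gS n).1. Qed.

Lemma limE_sym (x y : X) : limE S x y -> limE S y x.
Proof. by move=> xy n; rewrite (gS n).2. Qed.

(** Thread lifting in the sequence of adjacent pairs: bonding maps preserve edges downwards and are
    surjective on edges upwards. *)
Lemma limE_lift n (a b : sF S n) : fE _ a b ->
  exists x y : X, [/\ limE S x y, x @_ n = a & y @_ n = b].
Proof.
move=> ab.
have [|k [u w] /= uw|z [zf zP zn]] := @thread_lift (fun k => sF S k * sF S k)%type
  (fun k p => (sa S k p.1, sa S k p.2)) (fun k p => fE _ p.1 p.2) _ _ n (a, b) ab.
- by move=> k [u w] /=; have [[fe _ _] _] := SM.2 k; apply: fe.
- have [[_ _ fl] _] := SM.2 k; have [u' [w' [uw' <- <-]]] := fl _ _ uw.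
  by exists (u', w').
have [|x xz] := limVert_thread (x := fun k => (z k).1); first by move=> k; have /(congr1 fst) := zf k.
have [|y yz] := limVert_thread (x := fun k => (z k).2); first by move=> k; have /(congr1 snd) := zf k.
exists x, y; split; [|by rewrite xz zn|by rewrite yz zn].
by move=> k; rewrite xz yz; apply: zP.
Qed.

Lemma lproj_surj n (a : sF S n) : exists x : X, x @_ n = a.
Proof. by have [x [_ [_ <- _]]] := limE_lift ((gS n).1 a); exists x. Qed.

Lemma lproj_Fomega n : is_Fomega_epi S (sF S n) (lproj S n).
Proof.
split; last by exists n, id; split => //; apply: mono_epi_id.
split; [by move=> x y xy; apply: xy|exact: lproj_surj|exact: limE_lift].
Qed.

Lemma cylinder_nbhs n (x : X) : nbhs x [set y : X | y @_ n = x @_ n].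
Proof.
have cp : continuous (fun y : X => (y @_ n : discrete_topology (sF S n))).
  move=> y; apply: (@continuous_comp _ _ _ (set_val : X -> lprod S)
    (fun z : lprod S => z n)).
    exact: initial_continuous.
  exact: proj_continuous.
by have := cp x [set x @_ n]; apply; rewrite /nbhs /=.
Qed.

Lemma cylinder_open n (A : set (sF S n)) : open [set x : X | A (x @_ n)].
Proof.
rewrite openE => x Ax; rewrite /interior; apply: filterS (cylinder_nbhs n x) => y /= ->.
exact: Ax.
Qed.

Lemma cylinder_closed n (A : set (sF S n)) : closed [set x : X | A (x @_ n)].
Proof.
have -> : [set x : X | A (x @_ n)] = ~` [set x : X | (~` A) (x @_ n)].
  by apply/seteqP; split => x /=; [move=> ? []|move/contrapT].
exact/open_closedC/cylinder_open.
Qed.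

Lemma limVert_compact : compact [set: X].
Proof.
have cl : closed (limset S).
  move=> x xcl n.
  have B : nbhs x [set y : lprod S | y n.+1 = x n.+1 /\ y n = x n].
    apply: filterI.
      by have := @proj_continuous _ (fun n => discrete_topology (sF S n)) n.+1 x
        [set x n.+1]; apply; rewrite /nbhs /=.
    by have := @proj_continuous _ (fun n => discrete_topology (sF S n)) n x
      [set x n]; apply; rewrite /nbhs /=.
  by have [y [yl [<- <-]]] := xcl _ B; apply: yl.
have cp : compact [set: lprod S].
  have cpt i : compact [set: discrete_topology (sF S i)].
    by apply: finite_compact; apply: finite_finset.
  have := tychonoff cpt; congr (@compact _ _).
  by apply/seteqP; split.
have cL : compact (limset S) by apply: (subclosed_compact cl cp).
(* Transfer compactness from the closed subset of the product to the subtype: push the filter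
   forward along the inclusion and pull its cluster point back. *)
move=> F FF _.
have FF' : ProperFilter (fmap (set_val : X -> lprod S) F) by exact: fmap_proper_filter.
have lF : fmap (set_val : X -> lprod S) F (limset S).
  have : F [set y : X | limset S (set_val y)]; last by [].
  rewrite (_ : [set _ | _] = setT); first exact: filterT.
  by apply/seteqP; split => // y _; apply: set_valP.
have [x [xL xF]] := cL _ FF' lF.
have xl : x \in limset S by rewrite inE.
pose x' : X := exist _ x xl.
exists x'; split => // A B FA.
rewrite /nbhs /= => -[_ [[B' B'o <-] B'x] B'B].
have [||y [/= [z Az <-] B'z]] := xF (set_val @` A) B'.
- have : F [set z : X | (set_val @` A) (set_val z)]; last by [].
  by apply: filterS FA => z Az; exists z.
- by apply: open_nbhs_nbhs; split.
by exists z; split => //; apply: B'B.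
Qed.

Lemma closed_lproj (C : set X) (x : X) : closed C ->
  (forall n, exists2 y, C y & y @_ n = x @_ n) -> C x.
Proof.
move=> cC H.
have [||n|y yC] := @compact_nested _ (fun n => C `&` [set y : X | y @_ n = x @_ n]) limVert_compact.
- by move=> n; apply: closedI => //; apply: (@cylinder_closed n [set x @_ n]).
- by move=> n y [Cy yx]; split => //=; apply: (lproj_eq_le (leqnSn n)).
- by have [y Cy yx] := H n; exists y.
have -> : x = y by apply: limVert_ext => n; rewrite (yC n).2.
exact: (yC 0%N).1.
Qed.

Lemma closed_of_lproj (C : set X) :
  (forall x, (forall n, exists2 y, C y & y @_ n = x @_ n) -> C x) -> closed C.
Proof.
move=> H x xC; apply: H => n.
by have [y [Cy yx]] := xC _ (cylinder_nbhs n x); exists y.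
Qed.

Lemma closed_adj_lim (C : set X) (x : X) : closed C ->
  (forall n, exists2 y, C y & fE _ (x @_ n) (y @_ n)) -> exists2 y, C y & limE S x y.
Proof.
move=> cC H.
have [||n|y yC] := @compact_nested _ (fun n => C `&` [set y : X | fE _ (x @_ n) (y @_ n)])
  limVert_compact.
- by move=> n; apply: closedI => //; apply: (@cylinder_closed n (fun v => fE _ (x @_ n) v)).
- by move=> n y [Cy yx]; split => //=; apply: (lproj_adj_le (leqnSn n)).
- by have [y Cy yx] := H n; exists y.
by exists y; [case: (yC 0%N)|move=> n; case: (yC n)].
Qed.

(** Two nested intersections: the first fixes a point of [A] adjacent to [B] at every level, the
    second a single partner in [B]. *)
Lemma closed_adj_level (A B : set X) : closed A -> closed B ->
  (forall n, exists x y, [/\ A x, B y & fE _ (x @_ n) (y @_ n)]) ->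
  exists x y, [/\ A x, B y & limE S x y].
Proof.
move=> cA cB H.
have [||n|x xA] := @compact_nested _ (fun n => A `&`
  [set x : X | [set v | exists2 y, B y & fE _ v (y @_ n)] (x @_ n)]) limVert_compact.
- by move=> n; apply: closedI => //; apply: cylinder_closed.
- move=> n x [Ax [y By yx]]; split => //=; exists y => //.
  exact: (lproj_adj_le (leqnSn n)).
- by have [x [y [Ax By xy]]] := H n; exists x; split => //; exists y.
have [n|y By xy] := @closed_adj_lim B x cB; first by case: (xA n) => _ [y By]; exists y.
by exists x, y; split => //; case: (xA 0%N).
Qed.

(** The preimage of the image of [C] under the quotient map, expressed before any quotient is
    available. *)
Definition saturation (C : set X) : set X := [set y | exists2 x, C x & limE S y x].

Lemma saturation_closed (C : set X) : closed C -> closed (saturation C).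
Proof.
move=> cC; apply: closed_of_lproj => x H; apply: closed_adj_lim => // n.
by have [y [z Cz yz] <-] := H n; exists z.
Qed.

End Limit.

Lemma tree_nbr (G : tgraph) (v : G) : inTM3 G -> exists u, u \in nbrs v.
Proof.
move=> [tG [G2 _]].
have [b bv] : exists b, b != v.
  apply: contrapT => H; move: G2; rewrite ltnNge => /negP; apply.
  rewrite -(card1 v); apply: subset_leq_card; apply/boot.fintype.subsetP => x _.
  by rewrite inE; apply/negPn/negP => xv; apply: H; exists x.
have [[|u p]] := tree_gpath tG v b; move=> /and3P[].
  by move=> _ _ /= /eqP vb; rewrite vb eqxx in bv.
move=> /= /andP[vu _] /andP[+ _] _; rewrite inE negb_or => /andP[nvu _].
by exists u; rewrite boot.finset.inE eq_sym nvu.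
Qed.

Lemma subdivide_inTM3 (G : tgraph) (v u : G) : inTM3 G -> u \in nbrs v ->
  inTM3 (split_graph v (boot.finset.set1 u)).
Proof.
move=> GM uv; apply: split_inTM3 => //.
- by rewrite boot.finset.sub1set.
- by rewrite boot.finset.cards1.
- have := GM.2.2 v; rewrite /vorder -/(nbrs v) (boot.finset.cardsD1 u) uv /=.
  by rewrite add1n ltnS.
Qed.

Lemma subdivide_mono_epi (G : tgraph) (v u : G) : inTM3 G -> u \in nbrs v ->
  mono_epi (split_graph v (boot.finset.set1 u)) G (@collapse G v (boot.finset.set1 u)).
Proof. by move=> GM uv; apply: collapse_mono_epi => //; rewrite boot.finset.sub1set. Qed.

(** * Intervals and medians in the limit *)

Section LimitIntervals.
Context (S : invseq) (SM : invseq_in_TM3 S).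
Local Notation X := (limVert S).
Local Notation "x @_ n" := (lproj S n x) (at level 5).
Let tS n : is_tree (sF S n) := (SM.1 n).1.

Definition larc (c d : X) : set X := [set x | forall n, x @_ n \in seg (c @_ n) (d @_ n)].

Lemma larc_closed (c d : X) : closed (larc c d).
Proof.
by apply: closed_of_lproj => x H n; have [y /(_ n) yl <-] := H n.
Qed.

Lemma larc_lift (c d : X) n v : v \in seg (c @_ n) (d @_ n) ->
  exists2 x, larc c d x & x @_ n = v.
Proof.
move=> vi.
have [|k u ui|x [xf xP <-]] := @thread_lift (fun k => sF S k) (sa S)
  (fun k u => u \in seg (c @_ k) (d @_ k)) _ _ n v vi.
- move=> k u ui; have := mono_seg (tS k.+1) (tS k) (SM.2 k) ui.
  by rewrite !lproj_succ.
- by apply: (mono_seg_lift (tS k.+1) (tS k) (SM.2 k)); rewrite !lproj_succ.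
by have [y yx] := limVert_thread xf; exists y => // k; rewrite yx.
Qed.

Lemma larc_left c d : larc c d c.
Proof. by move=> n; apply: seg_left. Qed.

Lemma larc_right c d : larc c d d.
Proof. by move=> n; apply: seg_right. Qed.

Lemma lproj_seg_le n k (x y z : X) : (n <= k)%N ->
  z @_ k \in seg (x @_ k) (y @_ k) -> z @_ n \in seg (x @_ n) (y @_ n).
Proof.
move=> /(level_map SM)[f [mf fx]] /(mono_seg (tS k) (tS n) mf).
by rewrite !fx.
Qed.

Definition lmedian (a b c z : X) :=
  forall n, is_median (a @_ n) (b @_ n) (c @_ n) (z @_ n).

(** Bonding maps preserve medians and medians are unique, so the levelwise medians form a thread. *)
Lemma lmedian_exists a b c : exists z, lmedian a b c z.
Proof.
pose m n := cid (median_exists (tS n) (a @_ n) (b @_ n) (c @_ n)).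
have [|z zm] := @limVert_thread S (fun n => projT1 (m n)); last first.
  by exists z => n; rewrite zm; apply: (projT2 (m n)).
move=> n.
have := mono_median (tS n.+1) (tS n) (SM.2 n) (projT2 (m n.+1)).
by rewrite !lproj_succ => /(median_uniq (tS n)); apply; apply: (projT2 (m n)).
Qed.

Lemma lmedian_rot a b c z : lmedian a b c z -> lmedian b c a z.
Proof.
by move=> H n; have [zab zbc zac] := H n; split; rewrite // segC.
Qed.

(** From level [k] on, [z] is not between [a] and [r], since that interval shrinks to one vertex
    different from [z] at level [k]; so [z] stays on the intervals starting at [r]. Lower levels
    follow by projection. *)
Lemma lmedian_move k a b c z r : lmedian a b c z -> z @_ k <> a @_ k -> r @_ k = a @_ k ->
  lmedian r b c z.
Proof.
move=> H za ra.
have Hk m : (k <= m)%N -> is_median (r @_ m) (b @_ m) (c @_ m) (z @_ m).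
  move=> km; have [zab zbc zac] := H m.
  have zar : z @_ m \notin seg (a @_ m) (r @_ m).
    apply/negP => /(lproj_seg_le km); rewrite ra segxx // inE => /eqP; exact: za.
  split=> //.
    have := boot.fintype.subsetP (seg_subU (tS m) _ _ (r @_ m)) _ zab.
    by rewrite boot.finset.inE (negbTE zar).
  have := boot.fintype.subsetP (seg_subU (tS m) _ _ (r @_ m)) _ zac.
  by rewrite boot.finset.inE (negbTE zar).
move=> m; have [km|/ltnW mk] := leqP k m; first exact: Hk.
by have [h1 h2 h3] := Hk k (leqnn k); split; apply: lproj_seg_le mk _.
Qed.

End LimitIntervals.

(** * Consequences of the extension property *)

Section FraisseLimit.
Context (S : invseq) (FS : is_TM3_Fraisse_limit S).
Local Notation X := (limVert S).
Local Notation "x @_ n" := (lproj S n x) (at level 5).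
Let SM : invseq_in_TM3 S. Proof. by case: FS. Qed.
Let tS n : is_tree (sF S n) := (SM.1 n).1.

(** Finite form of the extension property: the lift of [lproj S n] through [g] factors through some
    level, which may be raised above [n]. *)
Lemma fraisse_ext n (B : tgraph) (g : B -> sF S n) : inTM3 B -> mono_epi B (sF S n) g ->
  exists k (h : sF S k -> B),
    [/\ (n <= k)%N, mono_epi (sF S k) B h & forall x : X, g (h (x @_ k)) = x @_ n].
Proof.
move=> BM mg; have [_ _ E] := FS.
have [h [[_ [m [h' [mh' hh']]]] gh]] := E _ _ _ g (SM.1 n) BM (lproj_Fomega SM n) mg.
have [f [mf fx]] := level_map SM (leq_maxr n m).
exists (maxn n m), (h' \o f); split; [exact: leq_maxl|exact: mono_epi_comp mf mh'|].
by move=> x; rewrite /= fx -hh' -gh.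
Qed.

Lemma limE_trans (x y z : X) : limE S x y -> limE S y z -> limE S x z.
Proof.
move=> xy yz n; apply: contrapT => /negP nxz.
have gT := (tS n).1.
have yx : fE _ (y @_ n) (x @_ n) by rewrite gT.2; apply: xy.
have xyn : x @_ n != y @_ n by apply: contra nxz => /eqP->; apply: yz.
have zyn : z @_ n != y @_ n by apply: contra nxz => /eqP->; apply: xy.
have zxn : z @_ n != x @_ n by apply: contra nxz => /eqP->; apply: gT.1.
have xnb : x @_ n \in nbrs (y @_ n) by rewrite boot.finset.inE xyn.
have [k [h [nk mh gh]]] :=
  fraisse_ext (subdivide_inTM3 (SM.1 n) xnb) (subdivide_mono_epi (SM.1 n) xnb).
have [[he _ _] _] := mh.
have := he _ _ (xy k); have := he _ _ (yz k).
move: (gh x) (gh y) (gh z).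
(* [h] cannot send [x] or [z] to [None], which collapses to the vertex of [y]. For [y], the value
   [Some] contradicts the removed edge to [x], and [None] is not adjacent to the image of [z]. *)
case: (h x @_ k) => [x'|]; rewrite /collapse /=; last first.
  by move=> xy'; rewrite xy' eqxx in xyn.
move=> ->; case: (h z @_ k) => [z'|]; last first.
  by move=> _ /= zy'; rewrite zy' eqxx in zyn.
case: (h y @_ k) => [y'|] /=; first move=> -> ->.
  by move=> _ /and3P[_ _]; rewrite boot.finset.inE !eqxx.
by move=> _ ->; rewrite boot.finset.inE (negbTE zyn) (negbTE zxn).
Qed.

(** Subdividing twice on the way to a neighbour puts a path of three vertices over [a]; points of
    the limit over its two ends are not adjacent. *)
Lemma fibre_nontrivial n (a : sF S n) :
  exists x y : X, [/\ x @_ n = a, y @_ n = a & ~ limE S x y].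
Proof.
have [u ua] := tree_nbr a (SM.1 n).
have B1M := subdivide_inTM3 (SM.1 n) ua; have m1 := subdivide_mono_epi (SM.1 n) ua.
set B1 := split_graph a _ in B1M m1.
have uN : (Some u : B1) \in nbrs (None : B1).
  by rewrite !boot.finset.inE /= boot.finset.inE eqxx orbT.
have B2M := subdivide_inTM3 B1M uN; have m2 := subdivide_mono_epi B1M uN.
have [k [h [nk mh gh]]] := fraisse_ext B2M (mono_epi_comp m2 m1).
have [[he hs _] _] := mh.
have [x' hx] := hs (Some (Some a)); have [y' hy] := hs None.
have [x xE] := lproj_surj SM x'; have [y yE] := lproj_surj SM y'.
exists x, y; split; [by rewrite -gh xE hx|by rewrite -gh yE hy|].
move=> /(_ k); rewrite xE yE => /he; rewrite hx hy /=.
rewrite boot.finset.inE /= => /eqP[au].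
by move: ua; rewrite boot.finset.inE au eqxx.
Qed.

(** Subdividing an edge at [v] and attaching a leaf to the new vertex yields a vertex [N] of order 3
    over [v]. The median of three points over its neighbours lies over [N]. *)
Lemma tripod_exists n (v : sF S n) : exists z y1 y2 y3 : X,
  [/\ z @_ n = v, lmedian y1 y2 y3 z & [/\ ~ limE S z y1, ~ limE S z y2 & ~ limE S z y3]].
Proof.
have [u uv] := tree_nbr v (SM.1 n).
have B1M := subdivide_inTM3 (SM.1 n) uv; have m1 := subdivide_mono_epi (SM.1 n) uv.
set B1 := split_graph v _ in B1M m1.
have uv' : u != v by move: uv; rewrite boot.finset.inE => /andP[].
have Q0 : boot.finset.set0 \subset nbrs (None : B1) by exact: boot.finset.sub0set.
have B2M : inTM3 (split_graph (None : B1) boot.finset.set0).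
  apply: split_inTM3; rewrite ?boot.finset.cards0 //.
  rewrite boot.finset.setD0.
  apply: leq_trans (_ : #|boot.finset.setU (boot.finset.set1 (Some v : B1)) (boot.finset.set1 (Some u))| <= _)%N.
    apply: subset_leq_card; apply/boot.fintype.subsetP => -[w|]; rewrite !boot.finset.inE //=.
    by rewrite boot.finset.inE.
  by rewrite boot.finset.cards2; case: (_ != _).
have m2 := collapse_mono_epi B1M Q0.
have tB := B2M.1.
set B2 := split_graph _ _ in B2M m2 tB.
pose N : B2 := Some None; pose a1 : B2 := Some (Some v); pose a2 : B2 := Some (Some u).
pose a3 : B2 := None.
have e1 : fE B2 N a1 by rewrite /= eqxx /= !boot.finset.inE.
have e2 : fE B2 N a2 by rewrite /= !boot.finset.inE eqxx orbT.
have e3 : fE B2 N a3 by [].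
have n12 : a1 != a2 by apply: contra uv' => /eqP [->].
have mN : is_median a1 a2 a3 N.
  by split; apply: seg_mid; rewrite // tB.1.2.
have [k [h [nk mh gh]]] := fraisse_ext B2M (mono_epi_comp m2 m1).
have [[_ hs _] _] := mh.
have lft a : exists y : X, h y @_ k = a.
  by have [y' <-] := hs a; have [y <-] := lproj_surj SM y'; exists y.
have [y1 h1] := lft a1; have [y2 h2] := lft a2; have [y3 h3] := lft a3.
have [z zm] := lmedian_exists SM y1 y2 y3.
have hz : h z @_ k = N.
  apply: (median_uniq tB) mN.
  by have := mono_median (tS k) tB mh (zm k); rewrite h1 h2 h3.
(* The vertex of [y] is only known to lie over a neighbour of [N], so [y] itself may be identified
   with [z]. The fibre over this vertex has two non-adjacent points, and by transitivity [z] cannot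
   be adjacent to both. *)
have far (y : X) : h y @_ k != N -> exists r : X, r @_ k = y @_ k /\ ~ limE S z r.
  move=> _; have [r [s [ry sy nrs]]] := fibre_nontrivial (y @_ k).
  have [zr|] := pselect (limE S z r); last by exists r.
  exists s; split => // zs; apply: nrs; apply: limE_trans zs.
  exact: limE_sym.
have zn (y : X) : h y @_ k != N -> z @_ k <> y @_ k.
  by move=> + zy; rewrite -zy hz eqxx.
have [|r1 [r1y r1z]] := far y1; first by rewrite h1.
have [|r2 [r2y r2z]] := far y2; first by rewrite h2.
have [|r3 [r3y r3z]] := far y3; first by rewrite h3.
exists z, r1, r2, r3; split => //.
  by rewrite -gh hz.
have z1 : z @_ k <> y1 @_ k by apply: zn; rewrite h1.
have z2 : z @_ k <> y2 @_ k by apply: zn; rewrite h2.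
have z3 : z @_ k <> y3 @_ k by apply: zn; rewrite h3.
(* Replace the three legs in turn; each rotation brings the next leg to the front, and three of them
   restore the order. *)
have q1 := lmedian_rot SM (lmedian_move SM zm z1 r1y).
have q2 := lmedian_rot SM (lmedian_move SM q1 z2 r2y).
exact: (lmedian_rot SM (lmedian_move SM q2 z3 r3y)).
Qed.

End FraisseLimit.

(** * The topological realization *)

Section LevelImages.
Context (S : invseq) (SM : invseq_in_TM3 S).
Local Notation X := (limVert S).
Local Notation "x @_ n" := (lproj S n x) (at level 5).
Let tS n : is_tree (sF S n) := (SM.1 n).1.

Definition level_image n (C : set X) : {set sF S n} :=
  locked (boot.finset.finset (fun v => `[< exists2 x, C x & x @_ n = v >])).

Lemma level_imageP n (C : set X) v :
  reflect (exists2 x, C x & x @_ n = v) (v \in level_image n C).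
Proof. by rewrite /level_image -lock boot.finset.inE; apply: asboolP. Qed.

Lemma level_image_le n k (C : set X) : (n <= k)%N ->
  gconnected _ (level_image k C) -> gconnected _ (level_image n C).
Proof.
move=> /(level_map SM)[f [[[fe _ _] _] fx]] /(gconnected_imset fe); congr gconnected.
apply/boot.finset.setP => v; apply/boot.finset.imsetP/level_imageP.
  by move=> [u /level_imageP[x Cx <-] ->]; exists x.
by move=> [x Cx <-]; exists (x @_ k) => //; apply/level_imageP; exists x.
Qed.

Lemma level_image_larc (c d : X) n : level_image n (larc c d) = seg (c @_ n) (d @_ n).
Proof.
apply/boot.finset.setP => v; apply/level_imageP/idP => [[x xl <-]//|/(larc_lift SM)].
exact.
Qed.

Lemma gconnected_star n (a : sF S n) : gconnected _ (boot.finset.finset (fE (sF S n) a)).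
Proof.
apply: gconnectedP => P x; rewrite boot.finset.inE => ax xP st.
have aP : a \in P.
  apply: (st x a) => //; rewrite ?boot.finset.inE //; first exact: (tS n).1.1.
  by rewrite (tS n).1.2.
apply/boot.fintype.subsetP => y; rewrite boot.finset.inE => ay.
by apply: (st a y) => //; rewrite ?boot.finset.inE //; apply: (tS n).1.1.
Qed.

(* By compactness, an edge between [P] and [Q] that is missing in the limit is already
   missing at some finite level. *)
Lemma closed_split_edge (C P Q : set X) : (forall n, gconnected _ (level_image n C)) ->
  closed P -> closed Q -> P !=set0 -> Q !=set0 -> P `<=` C -> Q `<=` C -> C `<=` P `|` Q ->
  exists x y, [/\ P x, Q y & limE S x y].
Proof.
move=> gC cP cQ [p Pp] [q Qq] PC QC CPQ.
apply: (closed_adj_level SM) => // n; apply: contrapT => H.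
have nPQ x y : P x -> Q y -> ~~ fE _ (x @_ n) (y @_ n).
  by move=> Px Qy; apply/negP => xy; apply: H; exists x, y.
apply: (gC n); exists (level_image n P), (level_image n Q); split.
- by apply/boot.finset.set0Pn; exists (p @_ n); apply/level_imageP; exists p.
- by apply/boot.finset.set0Pn; exists (q @_ n); apply/level_imageP; exists q.
- rewrite -boot.finset.setI_eq0; apply/eqP/boot.finset.setP => v.
  rewrite boot.finset.inE [RHS]boot.finset.inE; apply/negP => /andP[].
  move=> /level_imageP[x Px <-] /level_imageP[y Qy yx].
  by have := nPQ _ _ Px Qy; rewrite yx (tS n).1.1.
- apply/boot.finset.setP => v; rewrite boot.finset.inE; apply/level_imageP/orP.
    move=> [x Cx xv]; have [Px|Qx] := CPQ x Cx; [left|right];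
      by apply/level_imageP; exists x.
  by case=> /level_imageP[x Hx xv]; exists x => //; [apply: PC|apply: QC].
- by move=> _ _ /level_imageP[x Px <-] /level_imageP[y Qy <-]; apply: nPQ.
Qed.

End LevelImages.

(** * Topology of the quotient space *)

Section Quotient.
Context (S : invseq) (FS : is_TM3_Fraisse_limit S).
Local Notation X := (limVert S).
Local Notation "x @_ n" := (lproj S n x) (at level 5).
Let SM : invseq_in_TM3 S. Proof. by case: FS. Qed.
Let tS n : is_tree (sF S n) := (SM.1 n).1.
Context (Q : quotType X) (hQ : forall x y : X, \pi_Q x = \pi_Q y <-> limE S x y).
Local Notation Y := (quotient_topology Q).

Definition quo (x : X) : Y := \pi_Y x.

Lemma quo_eq x y : quo x = quo y <-> limE S x y.
Proof. by rewrite -hQ /quo !pi.unlock. Qed.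

Lemma quo_surj (y : Y) : exists x, quo x = y.
Proof. by exists (repr y); rewrite /quo reprK. Qed.

Lemma quo_closed (D : set Y) : closed D <-> closed (quo @^-1` D).
Proof.
by split => /closed_openC H; rewrite -[X in closed X]setCK; apply: open_closedC.
Qed.

Lemma quo_image_closed (C : set X) : closed C -> closed (quo @` C).
Proof.
move=> cC; apply/quo_closed; have := saturation_closed SM cC; congr closed.
apply/seteqP; split => x /=; first by move=> [y Cy xy]; exists y => //; apply/quo_eq/limE_sym.
by move=> [y Cy /quo_eq yx]; exists y => //; apply: limE_sym.
Qed.

Lemma quo_continuous : continuous quo.
Proof. exact: pi_continuous. Qed.

Lemma quo_compact : compact [set: Y].
Proof.
have -> : [set: Y] = quo @` setT.
  by apply/seteqP; split => // y _; have [x <-] := quo_surj y; exists x.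
apply: continuous_compact; last exact: (@limVert_compact S).
by apply: continuous_subspaceT; exact: quo_continuous.
Qed.

Definition quo_star n x : set Y := quo @` [set y : X | fE _ (x @_ n) (y @_ n)].

(** The classes all of whose representatives are adjacent to [x] at level [n]. Unlike [quo_star]
    this set is open, because the quotient map is closed. *)
Definition quo_open_star n x : set Y := ~` (quo @` [set y : X | ~~ fE _ (x @_ n) (y @_ n)]).

Lemma quo_open_star_open n x : open (quo_open_star n x).
Proof.
apply/closed_openC/quo_image_closed.
exact: (@cylinder_closed S n (fun v => ~~ fE _ (x @_ n) v)).
Qed.

Lemma quo_open_star_center n x : quo_open_star n x (quo x).
Proof. by move=> [y + /quo_eq yx] => /negP; apply; apply: limE_sym. Qed.

Lemma quo_open_starP n x y : quo_open_star n x (quo y) -> fE _ (x @_ n) (y @_ n).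
Proof. by move=> H; apply: contrapT => /negP nxy; apply: H; exists y. Qed.

Lemma quo_open_star_sub n x : quo_open_star n x `<=` quo_star n x.
Proof.
by move=> r; have [y <-] := quo_surj r => /quo_open_starP xy; exists y.
Qed.

(** If at every level some vertex were adjacent to both points, compactness would give a common
    neighbour in the limit and transitivity would identify them. So the open stars are disjoint at
    some level. *)
Lemma quo_hausdorff : hausdorff_space Y.
Proof.
rewrite open_hausdorff => p r /eqP; have [x <-] := quo_surj p; have [y <-] := quo_surj r.
move=> nxy; have [n H] : exists n, forall z : X, ~ (fE _ (x @_ n) (z @_ n) /\ fE _ (y @_ n) (z @_ n)).
  apply: contrapT => H; apply: nxy.
  have [||n|z zC] := @compact_nested _
    (fun n => [set z : X | fE _ (x @_ n) (z @_ n) /\ fE _ (y @_ n) (z @_ n)]) (@limVert_compact S).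
  - by move=> n; apply: (@cylinder_closed S n (fun v => fE _ (x @_ n) v /\ fE _ (y @_ n) v)).
  - by move=> n z [xz yz]; split; apply: (lproj_adj_le SM (leqnSn n)).
  - by apply: contrapT => Hn; apply: H; exists n => z zz; apply: Hn; exists z.
  apply/quo_eq; apply: (limE_trans FS (y := z)) => n; first by case: (zC n).
  by rewrite (tS n).1.2; case: (zC n).
exists (quo_open_star n x, quo_open_star n y) => /=.
  by rewrite !inE; split; apply: quo_open_star_center.
split; [exact: quo_open_star_open|exact: quo_open_star_open|].
apply/eqP/seteqP; split => // s [xs ys]; have [z zs] := quo_surj s.
by move: xs ys; rewrite -zs => /quo_open_starP xz /quo_open_starP yz; apply: (H z).
Qed.

(** If every star left [U], compactness would produce a point outside the preimage of [U] adjacent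
    to [x] in the limit, yet with the same class. *)
Lemma quo_star_small (U : set Y) x : open U -> U (quo x) ->
  exists n, quo_star n x `<=` U.
Proof.
move=> oU Ux; apply: contrapT => H.
have cU : closed (quo @^-1` (~` U)) by apply/quo_closed/open_closedC.
have [n|y nUy xy] := closed_adj_lim SM (x := x) cU; last first.
  by apply: nUy; have /quo_eq <- := xy.
apply: contrapT => Hn; apply: H; exists n => _ [y xy <-]; apply: contrapT => nU.
by apply: Hn; exists y.
Qed.

(** A relatively clopen proper part would split [C] into two closed pieces; the edge between them
    from [closed_split_edge] joins two points with the same class. *)
Lemma quo_connected (C : set X) : closed C -> (forall n, gconnected _ (level_image n C)) ->
  connected (quo @` C).
Proof.
move=> cC gC B [b Bb] [U oU BU] [K cK BK]; apply: contrapT => nB.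
have [y Cy nUy] : exists2 y, C y & ~ U (quo y).
  apply: contrapT => H; apply: nB; rewrite BU; apply/seteqP; split; first by move=> ? [].
  move=> _ [y Cy <-]; split; first by exists y.
  by apply: contrapT => nU; apply: H; exists y.
have := Bb; rewrite BK => -[[x Cx xb] Kb].
have [||||||z|p [r [[Cp Kp] [Cr nUr] /quo_eq pr]]] :=
  closed_split_edge SM (P := C `&` quo @^-1` K) (Q := C `&` quo @^-1` (~` U)) gC.
- by apply: closedI => //; apply/quo_closed.
- by apply: closedI => //; apply/quo_closed/open_closedC.
- by exists x; split; rewrite /= ?xb.
- by exists y.
- exact: subIsetl.
- exact: subIsetl.
- move=> Cz; have [Uz|nUz] := pselect (U (quo z)); last by right.
  left; split => //=.
  have : B (quo z) by rewrite BU; split => //; exists z.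
  by rewrite BK => -[].
have : B (quo p) by rewrite BK; split => //; exists p.
by rewrite BU => -[_ Up]; apply: nUr; rewrite -pr.
Qed.

(** A separation at level [n] gives closed images in [Y], disjoint because no edge joins the two
    sides; they would cut [D]. *)
Lemma connected_level (D : set Y) n : connected D -> gconnected _ (level_image n (quo @^-1` D)).
Proof.
move=> cD [P [R [/boot.finset.set0Pn[a aP] /boot.finset.set0Pn[b bR] dPR PRE nPR]]].
have [x Dx xa] : exists2 x, D (quo x) & x @_ n = a.
  by apply/level_imageP; rewrite PRE boot.finset.inE aP.
have [y Dy yb] : exists2 y, D (quo y) & y @_ n = b.
  by apply/level_imageP; rewrite PRE boot.finset.inE bR orbT.
pose KP := quo @` [set z : X | z @_ n \in P]; pose KR := quo @` [set z : X | z @_ n \in R].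
have cP : closed KP by apply/quo_image_closed/(@cylinder_closed S n [set` P]).
have cR : closed KR by apply/quo_image_closed/(@cylinder_closed S n [set` R]).
have disj r : KP r -> KR r -> False.
  move=> [z zP <-] [w wR /quo_eq /(_ n)]; have := nPR _ _ zP wR.
  by rewrite (tS n).1.2 => /negP.
have DE : D `&` KP = D `&` ~` KR.
  apply/seteqP; split => r [Dr Hr]; split => //; first by move=> /(disj r Hr).
  have [z zr] := quo_surj r.
  have : z @_ n \in P :|: R by rewrite -PRE; apply/level_imageP; exists z => //=; rewrite zr.
  rewrite boot.finset.inE => /orP[zP|zR]; first by exists z.
  by exfalso; apply: Hr; exists z.
have DKP : D `&` KP = D.
  apply: cD.
  - by exists (quo x); split => //; exists x; rewrite //= xa.
  - by exists (~` KR) => //; apply: closed_openC.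
  - by exists KP.
have [_ KPy] : (D `&` KP) (quo y) by rewrite DKP.
by apply: (disj _ KPy); exists y; rewrite //= yb.
Qed.

Lemma quo_star_connected n x : connected (quo_star n x).
Proof.
apply: quo_connected; first exact: (@cylinder_closed S n (fun v => fE _ (x @_ n) v)).
(* It suffices to look above level [n], where the image is the preimage of a star under a monotone
   map. *)
set C := [set y | _] => m; apply: (level_image_le SM (leq_maxl m n)).
have [f [[_ mf] fx]] := level_map SM (leq_maxr m n).
have := mf _ (@gconnected_star _ SM n (x @_ n)); congr gconnected.
apply/boot.finset.setP => v; rewrite !boot.finset.inE.
apply/idP/level_imageP => [xv|[y Cy <-]]; last by rewrite fx.
by have [y yv] := lproj_surj SM v; exists y => //; rewrite /C /= -(fx y) yv.
Qed.

(** Components of open sets are open: around each of its points a component contains a small star,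
    which is connected. *)
Lemma quo_locally_connected : locally_connected Y.
Proof.
move=> p U pU; have [V [oV Vp] VU] : exists2 V, open_nbhs p V & V `<=` U.
  by move: pU; rewrite nbhsE.
exists (connected_component V p); split.
- rewrite openE => r; have [x <-] := quo_surj r => px; rewrite /interior.
  have Vx : V (quo x) by apply: connected_component_sub px.
  have [n sV] := quo_star_small oV Vx.
  have on : nbhs (quo x) (quo_open_star n x).
    by apply: open_nbhs_nbhs; split; [apply: quo_open_star_open|apply: quo_open_star_center].
  apply: filterS on => s /quo_open_star_sub sx.
  apply: connected_component_trans px _.
  apply: (connected_component_max _ sV) => //; last exact: quo_star_connected.
  by exists x => //=; apply: (tS n).1.1.
- exact: connected_component_refl.
- exact: component_connected.
- exact: subset_trans (@connected_component_sub _ _ _) VU.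
Qed.

Lemma quo_larc_connected c d : connected (quo @` larc c d).
Proof.
apply: quo_connected; first exact: larc_closed.
by move=> n; rewrite (level_image_larc SM); apply: seg_gconnected.
Qed.

Lemma larc_sub_connected (D : set Y) c d : closed D -> connected D -> D (quo c) -> D (quo d) ->
  quo @` larc c d `<=` D.
Proof.
move=> clD cD Dc Dd _ [x xl <-].
have clD' : closed (quo @^-1` D) by apply/quo_closed.
apply: (closed_lproj SM clD') => n.
apply/level_imageP; have := xl n; apply/boot.fintype.subsetP.
apply: (seg_sub_gconnected (tS n)); first exact: connected_level.
  by apply/level_imageP; exists c.
by apply/level_imageP; exists d.
Qed.

(** [A] and [B] both contain the span of any two of their common points, so their intersection is
    the union of the connected spans from one fixed common point. *)
Lemma quo_hereditarily_unicoherent : hereditarily_unicoherent Y.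
Proof.
move=> _ _ A B [_ kA cA] [_ kB cB] _.
have clA := compact_closed quo_hausdorff kA; have clB := compact_closed quo_hausdorff kB.
have [->|/set0P[p [Ap Bp]]] := eqVneq (A `&` B) set0; first exact: connected0.
have [c cp] := quo_surj p; rewrite -cp in Ap Bp.
have -> : A `&` B = \bigcup_(d in [set d | (A `&` B) (quo d)]) quo @` larc c d.
  apply/seteqP; split => [r|r [d [Ad Bd] rl]].
    have [d <-] := quo_surj r => ABd; exists d => //; exists d => //.
    exact: larc_right.
  by split; [apply: (larc_sub_connected clA cA Ap Ad)|apply: (larc_sub_connected clB cB Bp Bd)].
apply: bigcup_connected; last by move=> d _; apply: quo_larc_connected.
by exists (quo c) => d _; exists c => //; apply: larc_left.
Qed.

Lemma quo_space_connected : connected [set: Y].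
Proof.
have -> : [set: Y] = quo @` setT.
  by apply/seteqP; split => // y _; have [x <-] := quo_surj y; exists x.
apply: quo_connected; first exact: closedT.
move=> n; have := tree_gconnected (tS n); congr gconnected.
apply/boot.finset.setP => v; rewrite boot.finset.inE; apply/esym/level_imageP.
by have [x xv] := lproj_surj SM v; exists x.
Qed.

Lemma quo_nonempty : [set: Y] !=set0.
Proof.
have /card_gt0P[v _] : (0 < #|sF S 0|)%N by apply: leq_trans (SM.1 0%N).2.1.
by have [x _] := lproj_surj SM v; exists (quo x).
Qed.

End Quotient.

(** * Metrization *)

Section DyadicSum.
Context {R : realType}.
Local Open Scope ring_scope.
Implicit Types a b : nat -> R.
Local Notation h := (2^-1 : R).

Definition dyadic_partial a N : R := \sum_(k < N) a k * h ^+ k.+1.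

(** The series with weights 2^-(k+1); for terms in the unit interval the partial sums increase, so
    the supremum is the sum. *)
Definition dyadic_sum a : R := sup (range (dyadic_partial a)).

Definition in_unit a := forall k, 0 <= a k <= 1.

Let h0 : 0 <= h. Proof. by rewrite invr_ge0. Qed.

Let hh : h + h = 1. Proof. by rewrite -[h]div1r -splitr. Qed.

Lemma half_pow_small (e : R) : 0 < e -> exists N, h ^+ N < e.
Proof.
move=> e0; have h1 : `|h| < 1 by rewrite ger0_norm // invf_lt1 // ltr1n.
have [N _ HN] : \forall n \near \oo, h ^+ n < e.
  by have /(@cvgr_lt _ _ _ _ _ 0) := cvg_expr h1; apply.
by exists N; apply: HN => /=.
Qed.

Lemma le_of_half_pow (x y : R) : (forall N, x <= y + h ^+ N) -> x <= y.
Proof.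
move=> H; apply/ler_addgt0Pr => e e0; have [N /ltW hN] := half_pow_small e0.
by apply: le_trans (H N) _; rewrite lerD2l.
Qed.

Lemma dyadic_partialS a N :
  dyadic_partial a N.+1 = dyadic_partial a N + a N * h ^+ N.+1.
Proof. by rewrite /dyadic_partial big_ord_recr. Qed.

Lemma dyadic_partial_le a N M : in_unit a -> (N <= M)%N ->
  dyadic_partial a N <= dyadic_partial a M.
Proof.
move=> ua; elim: M => [|M IH]; first by rewrite leqn0 => /eqP->.
rewrite leq_eqVlt => /orP[/eqP->//|/IH H]; apply: le_trans H _.
by rewrite dyadic_partialS lerDl mulr_ge0 ?exprn_ge0 //; case/andP: (ua M).
Qed.

Lemma dyadic_partial_tail a N M : in_unit a ->
  dyadic_partial a M <= dyadic_partial a N + h ^+ N.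
Proof.
(* The induction needs the exact geometric remainder 2^-N - 2^-(N+j). *)
move=> ua; have H j : dyadic_partial a (N + j) <= dyadic_partial a N + (h ^+ N - h ^+ (N + j)).
  elim: j => [|j IH]; first by rewrite addn0 subrr addr0.
  rewrite addnS dyadic_partialS.
  have a1 : a (N + j)%N * h ^+ (N + j).+1 <= h ^+ (N + j).+1.
    by rewrite ler_piMl ?exprn_ge0 //; case/andP: (ua (N + j)%N).
  have hE : h ^+ (N + j) = h ^+ (N + j).+1 + h ^+ (N + j).+1.
    by rewrite exprS -mulrDl hh mul1r.
  move: IH a1 hE; set p := dyadic_partial a (N + j); set q := dyadic_partial a N.
  by move: (_ * _) => s; move: (h ^+ N) (h ^+ (N + j)) (h ^+ (N + j).+1) => *; lra.
have [NM|/ltnW MN] := leqP N M.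
  rewrite -(subnKC NM); apply: le_trans (H _) _.
  by rewrite lerD2l gerBl exprn_ge0.
by apply: le_trans (dyadic_partial_le ua MN) _; rewrite lerDl exprn_ge0.
Qed.

Lemma dyadic_sum_ge a N : in_unit a -> dyadic_partial a N <= dyadic_sum a.
Proof.
move=> ua; apply: ub_le_sup; last by exists N.
by exists (dyadic_partial a 0 + h ^+ 0) => _ [M _ <-]; apply: dyadic_partial_tail.
Qed.

Lemma dyadic_sum_le a N : in_unit a -> dyadic_sum a <= dyadic_partial a N + h ^+ N.
Proof.
move=> ua; apply: ge_sup; first by exists (dyadic_partial a 0); exists 0%N.
by move=> _ [M _ <-]; apply: dyadic_partial_tail.
Qed.

Lemma dyadic_sum_triangle a b c : in_unit a -> in_unit b -> in_unit c ->
  (forall k, c k <= a k + b k) -> dyadic_sum c <= dyadic_sum a + dyadic_sum b.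
Proof.
move=> ua ub uc cab; apply: le_of_half_pow => N.
apply: le_trans (dyadic_sum_le N uc) _; rewrite lerD2r.
apply: le_trans (_ : dyadic_partial a N + dyadic_partial b N <= _); last first.
  by apply: lerD; apply: dyadic_sum_ge.
rewrite /dyadic_partial -big_split /=; apply: ler_sum => k _.
by rewrite -mulrDl ler_wpM2r ?exprn_ge0.
Qed.

Lemma dyadic_sum_mono a b : in_unit a -> in_unit b ->
  (forall k, a k <= b k) -> dyadic_sum a <= dyadic_sum b.
Proof.
move=> ua ub ab; apply: le_of_half_pow => N.
apply: le_trans (dyadic_sum_le N ua) _; rewrite lerD2r.
apply: le_trans (dyadic_sum_ge N ub); apply: ler_sum => k _.
by rewrite ler_wpM2r ?exprn_ge0.
Qed.

Lemma dyadic_sum_lt a b k : in_unit a -> in_unit b ->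
  (forall k, a k <= b k) -> a k < b k -> dyadic_sum a < dyadic_sum b.
Proof.
move=> ua ub ab abk; pose d := (b k - a k) * h ^+ k.+1.
have d0 : 0 < d by rewrite mulr_gt0 ?subr_gt0 // exprn_gt0 // invr_gt0.
suff : dyadic_sum a + d <= dyadic_sum b by apply: lt_le_trans; rewrite ltrDl.
(* [M] exceeds [k], so that the gap [d] is counted in the partial sums, and is at least [N], so that
   the tail stays below 2^-N. *)
apply: le_of_half_pow => N; pose M := maxn N k.+1.
have kM : (k < M)%N by rewrite leq_max leqnn orbT.
have hM : h ^+ M <= h ^+ N.
  by apply: ler_wiXn2l; rewrite ?leq_maxl // invf_le1 ?ler1n.
have pM : dyadic_partial a M + d <= dyadic_partial b M.
  rewrite /dyadic_partial (bigD1 (Ordinal kM)) //= [in leRHS](bigD1 (Ordinal kM)) //=.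
  have : \sum_(i < M | i != Ordinal kM) a i * h ^+ i.+1 <=
         \sum_(i < M | i != Ordinal kM) b i * h ^+ i.+1.
    by apply: ler_sum => i _; rewrite ler_wpM2r ?exprn_ge0.
  by rewrite /d mulrBl; move=> *; lra.
have := dyadic_sum_le M ua; have := dyadic_sum_ge M ub.
by move=> *; lra.
Qed.

(** Partial sums of fixed length converge, and the tails are uniformly below 2^-N; each contributes
    at most half of the error. *)
Lemma dyadic_sum_cvg (T : Type) (F : set_system T) {FF : Filter F} (f : T -> nat -> R) a :
  in_unit a -> (forall y, in_unit (f y)) ->
  (forall k, f y k @[y --> F] --> a k) -> dyadic_sum (f y) @[y --> F] --> dyadic_sum a.
Proof.
move=> ua uf fa; apply/cvgrPdist_lt => e e0.
have e2 : 0 < e / 2 by rewrite divr_gt0.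
have [N hN] := half_pow_small e2.
have : dyadic_partial (f y) N @[y --> F] --> dyadic_partial a N.
  elim: {hN} N => [|N IH].
    rewrite (_ : (fun y => _) = fun=> dyadic_partial a 0); first exact: cvg_cst.
    by apply/funext => y; rewrite /dyadic_partial !big_ord0.
  rewrite dyadic_partialS (_ : (fun y => _) =
    fun y => dyadic_partial (f y) N + f y N * h ^+ N.+1); last first.
    by apply/funext => y; rewrite dyadic_partialS.
  by apply: cvgD => //; apply: cvgM; [apply: fa|apply: cvg_cst].
move=> /cvgrPdist_lt /(_ _ e2); apply: filterS => y.
have := dyadic_sum_le N ua; have := dyadic_sum_ge N ua.
have := dyadic_sum_le N (uf y); have := dyadic_sum_ge N (uf y).
rewrite !ltr_norml => ? ? ? ? /andP[? ?]; apply/andP; split; lra.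
Qed.

Lemma dyadic_dist_continuous (T : topologicalType) (u : nat -> T -> R) (p : T) :
  (forall k, continuous (u k)) -> (forall r, in_unit (fun k => `|u k p - u k r|)) ->
  continuous (fun r => dyadic_sum (fun k => `|u k p - u k r|)).
Proof.
move=> uc u1 r; apply: dyadic_sum_cvg => // k.
by apply: cvg_norm; apply: cvgB; [exact: cvg_cst|exact: uc].
Qed.

Lemma open_dist_lt (T : topologicalType) (f : T -> R) (a e : R) :
  continuous f -> open [set p | `|a - f p| < e].
Proof.
move=> cf; have cd : continuous (fun p => `|a - f p|).
  by move=> p; apply: cvg_norm; apply: cvgB; [exact: cvg_cst|exact: cf].
exact: (open_comp (fun p _ => cd p) (@open_lt _ e)).
Qed.

End DyadicSum.

(** The metric is the dyadic sum of the differences of the [u k]. Its continuity makes balls open,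
    and compactness makes them a base. *)
Lemma dist_of_separating (R : realType) (T : topologicalType) (u : nat -> T -> R) :
  compact [set: T] -> (forall k, continuous (u k)) -> (forall k p, (0 <= u k p <= 1)%R) ->
  (forall p r, p <> r -> exists k, u k p <> u k r) ->
  exists d : T -> T -> R,
    [/\ forall x y, d x y = 0%R <-> x = y, forall x y, d x y = d y x,
        forall x y z, (d x z <= d x y + d y z)%R &
        forall U : set T, open U <->
          forall x, U x -> exists2 e : R, (0 < e)%R & [set y | (d x y < e)%R] `<=` U].
Proof.
Local Open Scope ring_scope.
move=> cT uc u01 us.
pose a p r k := `|u k p - u k r|.
have a01 p r : in_unit (a p r).
  move=> k; rewrite normr_ge0 /= ler_norml.
  by have := u01 k p; have := u01 k r; move=> /andP[? ?] /andP[? ?]; apply/andP; split; lra.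
pose d p r := dyadic_sum (a p r).
have axx p : d p p = 0.
  rewrite /d; have -> : a p p = fun=> 0 by apply/funext => k; rewrite /a subrr normr0.
  apply/eqP; rewrite eq_le; apply/andP; split.
    apply: ge_sup; first by exists (dyadic_partial (fun=> 0) 0); exists 0%N.
    by move=> _ [N _ <-]; rewrite /dyadic_partial big1 // => k _; rewrite mul0r.
  have u0 : in_unit (fun=> 0 : R) by move=> k; rewrite lexx ler01.
  by have := dyadic_sum_ge 0 u0; rewrite /dyadic_partial big_ord0.
have dlt p r : p <> r -> 0 < d p r.
  move=> /us[k uk]; rewrite -[X in X < _](axx p); apply: (@dyadic_sum_lt _ _ _ k) => //.
    by move=> j; rewrite /a subrr normr0 normr_ge0.
  by rewrite /a subrr normr0 normr_gt0 subr_eq0; apply/eqP.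
have d0 p r : d p r = 0 -> p = r.
  by move=> dpr; apply: contrapT => /dlt; rewrite dpr ltxx.
have dge p r : 0 <= d p r.
  by have [->|/eqP/dlt/ltW//] := eqVneq p r; rewrite axx.
have dcont p : continuous (d p) := dyadic_dist_continuous uc (a01 p).
exists d; split.
- by move=> p r; split; [apply: d0|move=> ->].
- by move=> p r; rewrite /d; congr dyadic_sum; apply/funext => k; rewrite /a distrC.
- move=> p r s; apply: dyadic_sum_triangle => // k; exact: ler_distD.
move=> U; split => [oU p Up|H]; last first.
  rewrite openE => p /H[e e0 sub]; rewrite /interior; apply: (filterS sub).
  have dp : d p r @[r --> p] --> d p p by exact: dcont.
  by rewrite axx in dp; apply: (cvgr_lt _ dp).
(* If no ball about [p] lay in [U], the closed balls of radius 2^-n would meet the complement of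
   [U], and nested compactness would give a point there at distance 0 from [p]. *)
apply: contrapT => nU.
have [||n|r rP] := @compact_nested T (fun n => ~` U `&` [set r | d p r <= 2^-1 ^+ n]) cT.
- move=> n; apply: closedI; first exact: open_closedC.
  have := (continuous_closedP (d p)).1 (dcont p) [set t | t <= 2^-1 ^+ n]; apply.
  exact: closed_le.
- move=> n r [nUr dr]; split => //=; apply: le_trans dr _.
  by apply: ler_wiXn2l; rewrite ?invr_ge0 // invf_le1 ?ler1n.
- apply: contrapT => Hn; apply: nU; exists (2^-1 ^+ n); first by rewrite exprn_gt0 // invr_gt0.
  by move=> r /= dr; apply: contrapT => nUr; apply: Hn; exists r; split => //=; apply: ltW.
have pr : p = r.
  apply: d0; apply/eqP; rewrite eq_le dge andbT.
  by apply: le_of_half_pow => N; rewrite add0r; case: (rP N).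
by case: (rP 0%N) => nUr _; apply: nUr; rewrite -pr.
Qed.

Section Metrization.
Context (S : invseq) (FS : is_TM3_Fraisse_limit S).
Local Notation X := (limVert S).
Local Notation "x @_ n" := (lproj S n x) (at level 5).
Let SM : invseq_in_TM3 S. Proof. by case: FS. Qed.
Let tS n : is_tree (sF S n) := (SM.1 n).1.
Context (Q : quotType X) (hQ : forall x y : X, \pi_Q x = \pi_Q y <-> limE S x y).
Local Notation Y := (quotient_topology Q).
Local Notation quo := (@quo S Q).
Local Open Scope ring_scope.

Definition no_edge n (A B : {set sF S n}) :=
  forall a b, a \in A -> b \in B -> ~~ fE (sF S n) a b.

(** Whole vertex sets of a level are separated, not only points: [arc_sup_lt] applies this to an
    interval and a vertex. *)
Definition separating (R : realType) (u : nat -> Y -> R) :=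
  [/\ forall k, continuous (u k),
      forall k p, 0 <= u k p <= 1 &
      forall n (A B : {set sF S n}), no_edge A B -> exists k,
        (forall x, x @_ n \in A -> u k (quo x) = 0) /\
        (forall x, x @_ n \in B -> u k (quo x) = 1)].

Lemma separating_exists (R : realType) : exists u : nat -> Y -> R, separating u.
Proof.
have normY := compact_normal (quo_hausdorff FS hQ) (@quo_compact S Q).
have ury n (A B : {set sF S n}) : no_edge A B -> exists f : Y -> R,
    [/\ continuous f, forall p, 0 <= f p <= 1,
      forall x, x @_ n \in A -> f (quo x) = 0 & forall x, x @_ n \in B -> f (quo x) = 1].
  move=> nAB.
  have cA : closed (quo @` [set x | x @_ n \in A]).
    by apply: (quo_image_closed FS hQ); apply: (@cylinder_closed S n [set` A]).
  have cB : closed (quo @` [set x | x @_ n \in B]).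
    by apply: (quo_image_closed FS hQ); apply: (@cylinder_closed S n [set` B]).
  have AB0 : quo @` [set x | x @_ n \in A] `&` quo @` [set x | x @_ n \in B] = set0.
    apply/seteqP; split => // _ [[x xA <-] [y yB /(quo_eq hQ)/(_ n)]].
    by rewrite (tS n).1.2 (negbTE (nAB _ _ xA yB)).
  have /(@uniform_separatorP _ R)[f [cf f01 f0 f1]] :=
    (@normal_separatorP R _).1 normY _ _ cA cB AB0.
  exists f; split=> //.
  - by move=> p; have /= := f01 (f p); rewrite in_itv /=; apply; exists p.
  - by move=> x xA; apply: (f0 (f (quo x))); exists (quo x) => //; exists x.
  - by move=> x xB; apply: (f1 (f (quo x))); exists (quo x) => //; exists x.
pose I := {n : nat & ({set sF S n} * {set sF S n})%type}.
have /choice[u uP] (k : nat) : exists f : Y -> R,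
    [/\ continuous f, forall p, 0 <= f p <= 1 &
      if @unpickle I k is Some (existT n AB) then no_edge AB.1 AB.2 ->
        (forall x, x @_ n \in AB.1 -> f (quo x) = 0) /\
        (forall x, x @_ n \in AB.2 -> f (quo x) = 1) else True].
  (* Default for indices that decode to no pair of vertex sets, or to a pair joined by an edge. *)
  have triv : exists f : Y -> R, continuous f /\ forall p, 0 <= f p <= 1.
    exists (fun=> 0); split => p; last by rewrite lexx ler01.
    exact: cst_continuous.
  case: unpickle => [[n [A B]]|] /=; last by have [f [? ?]] := triv; exists f.
  have [/ury[f [? ? ? ?]]|nAB] := pselect (no_edge A B); first by exists f.
  by have [f [? ?]] := triv; exists f.
exists u; split=> [k|k|n A B nAB]; [by case: (uP k)|by case: (uP k)|].
exists (pickle (existT _ n (A, B) : I)).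
by have [_ _] := uP (pickle (existT _ n (A, B) : I)); rewrite pickleK; apply.
Qed.

Lemma separating_points (R : realType) (u : nat -> Y -> R) x y : separating u -> ~ limE S x y ->
  exists k, u k (quo x) = 0 /\ u k (quo y) = 1.
Proof.
move=> [_ _ us] nxy; have [n /negP nn] : exists n, ~ fE _ (x @_ n) (y @_ n).
  by apply: contrapT => H; apply: nxy => n; apply: contrapT => Hn; apply: H; exists n.
have [|k [u0 u1]] := us n (boot.finset.set1 (x @_ n)) (boot.finset.set1 (y @_ n)).
  by move=> a b; rewrite !boot.finset.inE => /eqP-> /eqP->.
by exists k; split; [apply: u0|apply: u1]; rewrite boot.finset.inE.
Qed.

Lemma quo_metrizable : metrizable Y.
Proof.
have [u us] := separating_exists Rdefinitions.R; have [uc u01 _] := us.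
apply: (@dist_of_separating Rdefinitions.R _ _ (@quo_compact S Q) uc u01) => p r.
have [x <-] := quo_surj p; have [y <-] := quo_surj r.
rewrite (quo_eq hQ) => /(separating_points us)[k [u0 u1]].
by exists k; rewrite u0 u1; apply/eqP; rewrite eq_sym oner_eq0.
Qed.

End Metrization.

(** * Arcs and ramification points *)

Section LimitArcOrder.
Context (S : invseq) (SM : invseq_in_TM3 S).
Local Notation X := (limVert S).
Local Notation "x @_ n" := (lproj S n x) (at level 5).
Let tS n : is_tree (sF S n) := (SM.1 n).1.
Implicit Types (c d w x y : X).

Lemma larc_sub c y x : larc c x y -> larc c y `<=` larc c x.
Proof. by move=> yx w wy n; apply: (boot.fintype.subsetP (seg_subl (tS n) (yx n))). Qed.

(** Comparability passes down to lower levels. A level where one order fails forces the other at all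
    higher levels, hence at every level. *)
Lemma larc_total c d x y : larc c d x -> larc c d y -> larc c y x \/ larc c x y.
Proof.
move=> xl yl; have [|nxy] := pselect (larc c y x); [by left|right] => m.
have [n xn] : exists n, x @_ n \notin seg (c @_ n) (y @_ n).
  apply: contrapT => H; apply: nxy => n; apply: contrapT => /negP Hn.
  by apply: H; exists n.
apply: (lproj_seg_le SM (leq_maxl m n)).
have [xy|//] := seg_total (tS _) (xl (maxn m n)) (yl (maxn m n)).
by move: xn; rewrite (lproj_seg_le SM (leq_maxr m n) xy).
Qed.

Lemma larc_between c w x y : limE S x y -> larc c w y -> larc c x w -> limE S w x.
Proof.
move=> xy yw wx n.
have := seg_shift (tS n) (yw n) (wx n).
rewrite seg_adj //; last by rewrite (tS n).1.2.
rewrite !boot.finset.inE => /orP[]/eqP->; last exact: (tS n).1.1.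
by rewrite (tS n).1.2.
Qed.

End LimitArcOrder.

(** * A monotone parameter along an arc *)

Section ArcParameter.
Context (S : invseq) (FS : is_TM3_Fraisse_limit S).
Local Notation X := (limVert S).
Local Notation "x @_ n" := (lproj S n x) (at level 5).
Let SM : invseq_in_TM3 S. Proof. by case: FS. Qed.
Let tS n : is_tree (sF S n) := (SM.1 n).1.
Context (Q : quotType X) (hQ : forall x y : X, \pi_Q x = \pi_Q y <-> limE S x y).
Local Notation Y := (quotient_topology Q).
Local Notation quo := (@quo S Q).
Local Open Scope ring_scope.
Context (R : realType) (u : nat -> Y -> R) (us : separating u) (c d : X).
Let uc k : continuous (u k). Proof. by case: us. Qed.
Let u01 k p : 0 <= u k p <= 1. Proof. by case: us. Qed.

(** The running supremum of [u k] along the arc from [c], which makes it monotone. *)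
Definition arc_sup k x : R := sup [set u k (quo w) | w in larc c x].

Lemma arc_sup_ge k x w : larc c x w -> u k (quo w) <= arc_sup k x.
Proof.
move=> wx; apply: ub_le_sup; last by exists w.
by exists 1 => _ [v _ <-]; case/andP: (u01 k (quo v)).
Qed.

Lemma arc_sup_le k x m : (forall w, larc c x w -> u k (quo w) <= m) -> arc_sup k x <= m.
Proof.
move=> H; apply: ge_sup; first by exists (u k (quo c)); exists c => //; apply: larc_left.
by move=> _ [w wx <-]; apply: H.
Qed.

Lemma arc_sup_unit x : in_unit (arc_sup^~ x).
Proof.
move=> k; apply/andP; split; last by apply: arc_sup_le => w _; case/andP: (u01 k (quo w)).
by apply: le_trans (arc_sup_ge k (larc_left SM c x)); case/andP: (u01 k (quo c)).
Qed.

Lemma arc_sup_mono k x y : larc c y x -> arc_sup k x <= arc_sup k y.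
Proof.
by move=> xy; apply: arc_sup_le => w wx; apply: arc_sup_ge; apply: (larc_sub SM xy).
Qed.

Lemma arc_sup_near k x e : larc c d x -> 0 < e ->
  exists n, forall y, larc c d y -> y @_ n = x @_ n -> `|arc_sup k x - arc_sup k y| <= e.
Proof.
move=> xl e0; have e2 : 0 < e / 2 by rewrite divr_gt0.
have oU := open_dist_lt (u k (quo x)) (e / 2) (@uc k).
have [|n sU] := quo_star_small FS hQ (x := x) oU; first by rewrite /= subrr normr0.
have near w : w @_ n = x @_ n -> `|u k (quo x) - u k (quo w)| < e / 2.
  by move=> wx; apply: sU; exists w => //=; rewrite wx; apply: (tS n).1.1.
(* Beyond [y] the arc to [y'] stays over the vertex of [x], where [u k] differs from its value at
   [x] by less than [e / 2]; so the supremum grows by at most [e]. *)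
have step y y' : larc c y' y -> y @_ n = x @_ n -> y' @_ n = x @_ n ->
    arc_sup k y' <= arc_sup k y + e.
  move=> yy' yx y'x; apply: arc_sup_le => w wy'.
  have [wy|yw] := larc_total SM wy' yy'.
    by apply: le_trans (arc_sup_ge k wy) _; rewrite lerDl ltW.
  have wx : w @_ n = x @_ n.
    rewrite -yx; apply: (seg_anti (tS n) (c := c @_ n)) (yw n).
    by rewrite yx -y'x; apply: wy'.
  have := near w wx; have := near y yx; have := arc_sup_ge k (larc_right SM c y).
  by rewrite !ltr_norml => ? /andP[? ?] /andP[? ?]; lra.
exists n => y yl yx; rewrite ler_norml.
have [xy|yx'] := larc_total SM xl yl.
  have := step x y xy erefl yx; have := arc_sup_mono k xy.
  by move=> ? ?; apply/andP; split; lra.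
have := step y x yx' yx erefl; have := arc_sup_mono k yx'.
by move=> ? ?; apply/andP; split; lra.
Qed.

(** A point of the longer arc that is not on the shorter one lies between two adjacent points, hence
    has their class and adds no value of [u k]. *)
Lemma arc_sup_limE k x y : larc c d x -> larc c d y -> limE S x y ->
  arc_sup k x = arc_sup k y.
Proof.
wlog yx : x y / larc c x y.
  move=> H xl yl xy; have [xy'|yx] := larc_total SM xl yl; last exact: H.
  by apply/esym/H => //; apply: (limE_sym SM).
move=> xl yl xy; apply/eqP; rewrite eq_le; apply/andP; split; last exact: arc_sup_mono.
apply: arc_sup_le => w wx.
have [wy|yw] := larc_total SM wx yx; first exact: arc_sup_ge.
have /(quo_eq hQ) -> := larc_between SM xy yw wx.
by have /(quo_eq hQ) -> := xy; apply: arc_sup_ge; apply: larc_right.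
Qed.

Lemma arc_sup_lt x y : larc c y x -> ~ limE S x y -> exists k, arc_sup k x < arc_sup k y.
Proof.
move=> xy nxy; have [n /negP nn] : exists n, ~ fE _ (x @_ n) (y @_ n).
  by apply: contrapT => H; apply: nxy => n; apply: contrapT => Hn; apply: H; exists n.
have [_ _ /(_ n (seg (c @_ n) (x @_ n)) (boot.finset.set1 (y @_ n)))] := us.
case=> [a b ax|k [u0 u1]].
  (* If a vertex [a] before [x] were adjacent to [y], then [x], being between them, would be one of
     the two and so adjacent to [y]. *)
  rewrite boot.finset.inE => /eqP->; apply: contra nn => ay.
  have := seg_shift (tS n) ax (xy n); rewrite seg_adj // !boot.finset.inE.
  by move=> /orP[]/eqP->; rewrite // (tS n).1.1.
exists k; apply: (@le_lt_trans _ _ 0); first by apply: arc_sup_le => w wx; rewrite u0.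
apply: lt_le_trans (arc_sup_ge k (larc_right SM c y)).
by rewrite u1 ?ltr01 // boot.finset.inE.
Qed.

Definition arc_height x : R := dyadic_sum (arc_sup^~ x).

Lemma arc_height_lt x y : larc c y x -> ~ limE S x y -> arc_height x < arc_height y.
Proof.
move=> xy nxy; have [k kxy] := arc_sup_lt xy nxy.
by apply: (dyadic_sum_lt (k := k)) => // [||j]; [exact: arc_sup_unit..|exact: arc_sup_mono].
Qed.

Lemma arc_height_le x y : larc c y x -> arc_height x <= arc_height y.
Proof.
by move=> xy; apply: dyadic_sum_mono => [||j]; [exact: arc_sup_unit..|exact: arc_sup_mono].
Qed.

Lemma arc_height_eq x y : larc c d x -> larc c d y ->
  (limE S x y <-> arc_height x = arc_height y).
Proof.
move=> xl yl; split=> [xy|hxy].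
  by congr dyadic_sum; apply/funext => k; apply: arc_sup_limE.
apply: contrapT => nxy; have [xy|yx] := larc_total SM xl yl.
  by have := arc_height_lt xy nxy; rewrite hxy ltxx.
have := arc_height_lt yx (fun yx => nxy (limE_sym SM yx)).
by rewrite hxy ltxx.
Qed.

Lemma arc_height_continuous : {within larc c d, continuous arc_height}.
Proof.
apply/subspace_continuousP => x xl.
apply: dyadic_sum_cvg; [exact: arc_sup_unit|exact: arc_sup_unit|move=> k].
apply/cvgrPdist_le => e e0; have [n H] := arc_sup_near k xl e0.
rewrite /within /=; apply: filterS (cylinder_nbhs n x) => y /= yx yl.
exact: H.
Qed.

Lemma arc_parameter : ~ limE S c d -> exists f : X -> R,
  [/\ f c = 0, f d = 1, forall x, larc c d x -> 0 <= f x <= 1,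
      forall x y, larc c d x -> larc c d y -> (limE S x y <-> f x = f y) &
      {within larc c d, continuous f}].
Proof.
move=> ncd; have cl := larc_left SM c d; have dl := larc_right SM c d.
have lt := arc_height_lt cl ncd.
pose g := arc_height d - arc_height c; have g0 : 0 < g by rewrite subr_gt0.
exists (fun x => (arc_height x - arc_height c) / g); split.
- by rewrite subrr mul0r.
- by rewrite divff // gt_eqF.
- move=> x xl; apply/andP; split.
    rewrite mulr_ge0 ?invr_ge0 ?(ltW g0) // subr_ge0; apply: arc_height_le => n.
    exact: seg_left.
  by rewrite ler_pdivrMr // mul1r lerD2r arc_height_le.
- move=> x y xl yl; split=> [/(arc_height_eq xl yl)->//|].
  by move=> /(mulIf (invr_neq0 (lt0r_neq0 g0))) /addIr /(arc_height_eq xl yl).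
- move=> x; apply: cvgM; last exact: cvg_cst.
  by apply: cvgB; [exact: arc_height_continuous|exact: cvg_cst].
Qed.

End ArcParameter.

(** * Arcs, the dendrite property and ramification points *)

Section Dendrite.
Context (S : invseq) (FS : is_TM3_Fraisse_limit S).
Local Notation X := (limVert S).
Local Notation "x @_ n" := (lproj S n x) (at level 5).
Let SM : invseq_in_TM3 S. Proof. by case: FS. Qed.
Let tS n : is_tree (sF S n) := (SM.1 n).1.
Context (Q : quotType X) (hQ : forall x y : X, \pi_Q x = \pi_Q y <-> limE S x y).
Local Notation Y := (quotient_topology Q).
Local Notation quo := (@quo S Q).
Local Notation R := Rdefinitions.R.

Lemma quo_larc_is_arc c d : ~ limE S c d -> is_arc Y (quo @` larc c d) (quo c) (quo d).
Proof.
have [u us] := separating_exists FS hQ R.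
move=> /(arc_parameter FS hQ us)[f [fc fd f01 f_eq fcont]].
have cl := larc_left SM c d; have dl := larc_right SM c d.
have larcK : closed (larc c d) by exact: larc_closed.
have sub_compact (K : set X) : closed K -> K `<=` larc c d -> compact (f @` K).
  move=> cK Kl; apply: continuous_compact; first exact: continuous_subspaceW fcont.
  exact: subclosed_compact cK (@limVert_compact S) _.
have preim_closed (D : set R) : closed D -> closed (larc c d `&` f @^-1` D).
  move=> cD; have /closed_subspaceP[V cV VE] := (continuous_closedP _).1 fcont D cD.
  by rewrite setIC -VE; apply: closedI.
(* Intermediate values: the closed parts where [f] is at most [t] and at least [t] cover the arc, so
   an edge joins them; adjacent points share their value, which must be [t]. *)
have fsurj t : I01 t -> exists2 x, larc c d x & f x = t.
  move=> t01; apply: contrapT => nt.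
  pose P := larc c d `&` f @^-1` [set s | (s <= t)%R].
  pose P' := larc c d `&` f @^-1` [set s | (t <= s)%R].
  have [n|||||||x|x [y [[xl /= xt] [yl /= ty] xy]]] := closed_split_edge SM (C := larc c d) (P := P) (Q := P').
  - by rewrite level_image_larc //; apply: seg_gconnected.
  - by apply: preim_closed; apply: closed_le.
  - by apply: preim_closed; apply: closed_ge.
  - by exists c; split; rewrite //= fc; case/andP: t01.
  - by exists d; split; rewrite //= fd; case/andP: t01.
  - exact: subIsetl.
  - exact: subIsetl.
  - by move=> xl; have [xt|/ltW tx] := leP (f x) t; [left|right].
  apply: nt; exists x => //; apply/eqP; rewrite eq_le xt /=.
  by rewrite (f_eq x y xl yl).1.
(* A section of [f]; outside the unit interval it is unconstrained and [c] serves as a default. By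
   [gf] the class of the chosen point does not depend on the choice. *)
have /choice[g gP] (t : R) : exists x, I01 t -> larc c d x /\ f x = t.
  have [/fsurj[x xl xt]|nt] := pselect (I01 t); first by exists x.
  by exists c.
have gf x : larc c d x -> quo (g (f x)) = quo x.
  move=> xl; have [gl gE] := gP (f x) (f01 x xl).
  by apply/(quo_eq hQ)/f_eq.
exists (quo \o g); split.
(* The preimage of a closed [D] is the image under [f] of a compact set, hence closed. *)
- apply/continuous_closedP => D cD; apply/closed_subspaceP.
  exists (f @` (larc c d `&` quo @^-1` D)).
    apply: compact_closed; first exact: (@Rhausdorff (R : realType)).
    apply: sub_compact; last exact: subIsetl.
    by apply: closedI => //; apply/quo_closed.
  apply/seteqP; split=> [_ [[x [xl xD] <-] f01x]|t [tD t01]].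
    by split => //=; rewrite /from_subspace /= gf.
  have [gl gE] := gP t t01; split => //; exists (g t) => //; split => //.
- move=> s t s01 t01 /(quo_eq hQ) gst; have [gs gsE] := gP s s01; have [gt gtE] := gP t t01.
  by rewrite -gsE -gtE; apply/f_eq.
- apply/seteqP; split=> [_ [t t01 <-]|_ [x xl <-]]; first by exists (g t) => //; case: (gP t t01).
  by exists (f x); [exact: f01|rewrite /= gf].
(* The open set is the complement of the image of the part of the arc where [f] lies outside [U];
   that image is closed because the quotient map is. *)
- move=> U oU; exists (~` (quo @` (larc c d `&` f @^-1` (~` U)))).
    apply/closed_openC/(quo_image_closed FS hQ)/preim_closed; exact: open_closedC.
  apply/seteqP; split=> [_ [t [Ut t01] <-]|p [np [x xl xp]]].
    have [gl gE] := gP t t01; split; last by exists (g t).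
    move=> [x [xl nU] /(quo_eq hQ) xg]; apply: nU.
    by rewrite (f_eq x (g t) xl gl).1 // gE.
  exists (f x); last by rewrite /= gf.
  split; last exact: f01.
  by apply: contrapT => nU; apply: np; exists x.
- have I0 : I01 (0%R : R) by rewrite /I01 /= lexx ler01.
  have I1 : I01 (1%R : R) by rewrite /I01 /= lexx ler01.
  by split; rewrite /= -?[in LHS]fc -?[in LHS]fd gf.
Qed.

Lemma quo_dendrite : dendrite Y.
Proof.
split.
- split; [exact: quo_nonempty|exact: quo_compact|exact: quo_space_connected| |].
    exact: quo_hausdorff.
  exact: quo_metrizable.
- exact: quo_locally_connected.
- exact: quo_hereditarily_unicoherent.
- move=> p r; have [x <-] := quo_surj p; have [y <-] := quo_surj r.
  by rewrite (quo_eq hQ) => /quo_larc_is_arc; exists (quo @` larc x y).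
Qed.

(** If points of the two arcs have the same class, then at each level [z] lies between their two
    adjacent vertices, hence is one of them and adjacent to the other. *)
Lemma larc_meet (x y z : X) : (forall n, z @_ n \in seg (x @_ n) (y @_ n)) ->
  (quo @` larc z x) `&` (quo @` larc z y) = [set quo z].
Proof.
move=> zxy; apply/seteqP; split=> [p [[a az <-] [b bz /(quo_eq hQ) ba]]|_ ->]; last first.
  by split; exists z => //; apply: larc_left.
apply/(quo_eq hQ) => n.
have h1 : z @_ n \in seg (a @_ n) (y @_ n).
  by apply: (seg_shift (tS n)) (zxy n); rewrite segC //; apply: az.
have : z @_ n \in seg (b @_ n) (a @_ n).
  apply: (seg_shift (tS n) (x := y @_ n)); first by rewrite segC //; apply: bz.
  by rewrite segC.
rewrite seg_adj // !boot.finset.inE => /orP[]/eqP->; last exact: (tS n).1.1.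
by rewrite (tS n).1.2.
Qed.

(** Every nonempty open set contains a star, and a tripod centre exists over the central vertex of
    that star. *)
Lemma quo_ramification_dense : dense [set p : Y | ramification_point Y p].
Proof.
move=> U [p Up] oU; have [x xp] := quo_surj p; rewrite -xp in Up.
have [n sU] := quo_star_small FS hQ oU Up.
have [z [y1 [y2 [y3 [zx zm [z1 z2 z3]]]]]] := tripod_exists FS (x @_ n).
exists (quo z); split.
  by apply: sU; exists z => //=; rewrite zx; apply: (tS n).1.1.
exists (quo @` larc z y1), (quo @` larc z y2), (quo @` larc z y3), (quo y1), (quo y2), (quo y3).
split; first by split; apply: quo_larc_is_arc.
by split; apply: larc_meet => m; case: (zm m).
Qed.

End Dendrite.

Lemma limE_quotient (S : invseq) : is_TM3_Fraisse_limit S ->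
  exists Q : quotType (limVert S), forall x y : limVert S, \pi_Q x = \pi_Q y <-> limE S x y.
Proof.
move=> FS; have SM : invseq_in_TM3 S by case: FS.
pose e (x y : limVert S) := `[< limE S x y >].
have er : equiv_class_of e.
  split=> [x|x y|y x z].
  - exact/asboolP/limE_refl.
  - by apply/asboolP/asboolP; apply: (limE_sym SM).
  - by move=> /asboolP xy /asboolP yz; apply/asboolP; apply: (limE_trans FS) xy yz.
exists {eq_quot (EquivRelPack er)} => x y; split.
  by move=> /eqmodP /asboolP.
by move=> xy; apply/eqmodP/asboolP.
Qed.

Unset Implicit Arguments.

(** The realization is any quotient type whose classes are those of the edge relation; the middle
    clause provides one, so the last clause is not vacuous. *)
Theorem theorem3p14 (S : invseq) :
  is_TM3_Fraisse_limit S ->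
  (forall x y z : limVert S, limE S x y -> limE S y z -> limE S x z) /\
  (exists Q : quotType (limVert S), forall x y : limVert S, \pi_Q x = \pi_Q y <-> limE S x y) /\
  (forall Q : quotType (limVert S),
     (forall x y : limVert S, \pi_Q x = \pi_Q y <-> limE S x y) ->
     dendrite (quotient_topology Q) /\
     dense [set p : quotient_topology Q | ramification_point (quotient_topology Q) p]).
Proof.
move=> FS; split; first exact: limE_trans.
split; first exact: limE_quotient.
by move=> Q hQ; split; [exact: quo_dendrite|exact: quo_ramification_dense].
Qed.
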